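(* Let $k,p$ be positive real numbers and let $x,y\in\mathbb{C}$ with $\mathrm{Re}(x)>0$ and $\mathrm{Re}(y)>0$. Then $${}_{p}B_{k}(x,y)=\frac1k\int_{0}^{1}t^{\frac{x}{k}-1}(1-t)^{\frac{y}{k}-1}\,dt,$$ $${}_{p}B_{k}(x,y)=\frac1k\int_{0}^{1}\frac{t^{\frac{x}{k}-1}+t^{\frac{y}{k}-1}}{(t+1)^{\frac{x+y}{k}}}\,dt,$$ $${}_{p}B_{k}(x,y)=\int_{0}^{\infty}t^{x-1}(1+t^{k})^{-\frac{x+y}{k}}\,dt,$$ $${}_{p}B_{k}(x,y)=\frac1k\,B\left(\frac{x}{k},\frac{y}{k}\right),$$ where $B$ is the classical Beta function.
   Context: The p-k Pochhammer symbol is ${}_{p}(x)_{n,k}=\left(\frac{xp}{k}\right)\left(\frac{xp}{k}+p\right)\cdots\left(\frac{xp}{k}+(n-1)p\right)$. The p-k Gamma function is, for $\mathrm{Re}(x)>0$, $${}_{p}\Gamma_{k}(x)=\frac1k\lim_{n\to\infty}\frac{n!\,p^{n+1}(np)^{x/k}}{{}_{p}(x)_{n+1,k}}=\frac1k\lim_{n\to\infty}\frac{n!\,p^{n+1}(np)^{\frac{x}{k}-1}}{{}_{p}(x)_{n,k}}.$$ The p-k Beta function is ${}_{p}B_{k}(x,y)=\dfrac{{}_{p}\Gamma_{k}(x)\;{}_{p}\Gamma_{k}(y)}{{}_{p}\Gamma_{k}(x+y)}$ for $\mathrm{Re}(x)>0$, $\mathrm{Re}(y)>0$. For a positive real base $c$,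 $c^{z}=e^{z\ln c}$. *)

(* Defs.v *)
From Stdlib Require Import Reals Factorial.
From Coquelicot Require Import Coquelicot.

Open Scope R_scope.

Definition Cexp (z : C) : C :=
  (exp (Re z) * cos (Im z), exp (Re z) * sin (Im z)).

(* Principal power of a real base; it has its usual meaning only for [0 < c],
   because [ln] is a junk value elsewhere. *)
Definition Rcpow (c : R) (z : C) : C := Cexp (z * RtoC (ln c))%C.

Fixpoint pk_pochhammer (p k : R) (x : C) (n : nat) : C :=
  match n with
  | O => RtoC 1
  | S m => (pk_pochhammer p k x m * (x * p / k + INR m * p))%C
  end.

Definition pk_gamma_seq (p k : R) (x : C) (n : nat) : C :=
  (INR (fact n) * RtoC (p ^ S n) * Rcpow (INR n * p) (x / k)
     / pk_pochhammer p k x (S n))%C.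

(* [lim] is a total operator; the limit exists whenever
   [0 < p], [0 < k] and [0 < Re x]. *)
Definition pk_gamma (p k : R) (x : C) : C :=
  (1 / k * lim (T := C_R_CompleteNormedModule)
             (filtermap (pk_gamma_seq p k x) eventually))%C.

Definition pk_beta (p k : R) (x y : C) : C :=
  (pk_gamma p k x * pk_gamma p k y / pk_gamma p k (x + y))%C.

Definition beta_integrand (a b : C) (t : R) : C :=
  (Rcpow t (a - 1) * Rcpow (1 - t) (b - 1))%C.

(* The endpoints are reached as limits because the integrand may be
   unbounded there. *)
Definition Beta (a b : C) : C :=
  RInt_gen (V := C_R_CompleteNormedModule)
    (beta_integrand a b) (at_right 0) (at_left 1).

(* Main.v *)
(** Put [a = x/k], [b = y/k]. Pulling powers of [p] out of the Pochhammer symbol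
    turns the limit defining the p-k Gamma function into [p^a / k] times the Gauss
    product [G_n(a) = n! n^a / (a (a+1) ... (a+n))]; consecutive ratios of [G_n] are
    [1 + O(1/n^2)], so it has a nonzero limit. Integration by parts gives
    [B(a, b+1) = b/(a+b) B(a, b)], whence [G_n(a) = n^a B(a, n+1)] and
    [G_n(a+b) B(a, b) = G_n(b) n^a B(a, b+n+1)]. Since [|1 - (1-t)^b| <= K t], replacing
    [B(a, b+n+1)] by [B(a, n+1)] costs only [O(1/n)] after multiplication by [n^a], and
    [G(a) G(b) = G(a+b) B(a, b)] follows in the limit. The other two integrals are
    substitutions performed on a primitive of the Beta integrand. *)

Require Import Defs.
From Stdlib Require Import Reals Lra Lia Factorial.
From Coquelicot Require Import Coquelicot.

Open Scope R_scope.

(** Complex powers are not monotone, so estimates pass through [Cmod (Rcpow t z) = Rpower t (Re z)]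
    to real majorants whose primitive or Beta value is explicit. Gamma never appears as an integral:
    with [gauss] and integer shifts of a parameter there is no double integral and no interchange of
    limit and integral. The limit must be shown nonzero because [pk_beta] divides by it, and
    convergence alone does not exclude zero. Since [lim] and [RInt_gen] are total operators,
    convergence is proved first and values are then identified by uniqueness. Working with a
    primitive that has limits at both endpoints turns a substitution into a composition: the
    transformed integral converges because the inner function has the right limits, and no new
    domination argument is required. *)

Notation is_deriveC := (is_derive (K := R_AbsRing) (V := C_R_NormedModule)).

(** * Complex-valued functions of a real variable *)

Lemma C_R_norm (z : C) : norm (z : C_R_NormedModule) = Cmod z.
Proof.
  destruct z as [u v]; unfold Cmod; simpl.
  unfold norm; simpl; unfold prod_norm, norm; simpl; unfold abs; simpl.
  f_equal. rewrite !Rmult_1_r, <- !Rabs_mult, !Rabs_pos_eq; nra.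
Qed.

(** Neighbourhoods in the product structure are squares, whereas [Cmod] measures discs. A square of
    radius [eps / sqrt 2] fits in the disc of radius [eps], and a disc fits in the square of the
    same radius. *)
Lemma filterlim_Cmod {T : Type} (F : (T -> Prop) -> Prop) {FF : Filter F} (f : T -> C) (l : C) :
  filterlim f F (locally l) <->
  forall eps : R, 0 < eps -> F (fun t => Cmod (f t - l) < eps).
Proof.
  split; intros H.
  - intros eps He.
    assert (Hs : 0 < sqrt 2) by (apply sqrt_lt_R0; lra).
    assert (He' : 0 < eps / sqrt 2) by (apply Rdiv_lt_0_compat; lra).
    generalize (H _ (locally_ball l (mkposreal _ He'))). unfold filtermap.
    apply filter_imp; intros t Ht.
    apply (C_NormedModule_mixin_compat2 _ _ (mkposreal _ He')) in Ht.
    simpl in Ht. replace (sqrt 2 * (eps / sqrt 2)) with eps in Ht by (field; lra).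
    exact Ht.
  - apply filterlim_locally. intros eps.
    generalize (H eps (cond_pos eps)). apply filter_imp; intros t Ht.
    apply C_NormedModule_mixin_compat1. exact Ht.
Qed.

Lemma filterlim_C_plus {T : Type} (F : (T -> Prop) -> Prop) {FF : Filter F} (f g : T -> C) (l m : C) :
  filterlim f F (locally l) -> filterlim g F (locally m) ->
  filterlim (fun t => f t + g t)%C F (locally (l + m)%C).
Proof.
  rewrite !(filterlim_Cmod F). intros Hf Hg eps He.
  generalize (filter_and (F := F) _ _ (Hf (eps / 2) ltac:(lra)) (Hg (eps / 2) ltac:(lra))).
  apply filter_imp; intros t [H1 H2].
  replace (f t + g t - (l + m))%C with ((f t - l) + (g t - m))%C by ring.
  generalize (Cmod_triangle (f t - l) (g t - m)); lra.
Qed.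

Lemma filterlim_C_mult {T : Type} (F : (T -> Prop) -> Prop) {FF : Filter F} (f g : T -> C) (l m : C) :
  filterlim f F (locally l) -> filterlim g F (locally m) ->
  filterlim (fun t => f t * g t)%C F (locally (l * m)%C).
Proof.
  rewrite !(filterlim_Cmod F). intros Hf Hg eps He.
  assert (H0 := Cmod_ge_0 l). assert (H1 := Cmod_ge_0 m).
  set (d := Rmin 1 (eps / (Cmod l + Cmod m + 1))).
  assert (Hd : 0 < d).
  { apply Rmin_glb_lt; [lra|]. apply Rdiv_lt_0_compat; lra. }
  assert (Hd1 : d <= 1) by apply Rmin_l.
  assert (Hd2 : d * (Cmod l + Cmod m + 1) <= eps).
  { apply Rle_div_r; [lra|]. apply Rmin_r. }
  generalize (filter_and (F := F) _ _ (Hf d Hd) (Hg d Hd)).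
  apply filter_imp; intros t [H2 H3].
  replace (f t * g t - l * m)%C
    with ((f t - l) * (g t - m) + ((f t - l) * m + l * (g t - m)))%C by ring.
  eapply Rle_lt_trans; [apply Cmod_triangle|].
  eapply Rle_lt_trans; [apply Rplus_le_compat_l, Cmod_triangle|].
  rewrite !Cmod_mult.
  assert (H4 := Cmod_ge_0 (f t - l)). assert (H5 := Cmod_ge_0 (g t - m)).
  eapply Rlt_le_trans; [|exact Hd2]. nra.
Qed.

Lemma filterlim_C_unique {T : Type} (F : (T -> Prop) -> Prop) {FF : ProperFilter F} (f : T -> C) (l m : C) :
  filterlim f F (locally l) -> filterlim f F (locally m) -> l = m.
Proof. apply (filterlim_locally_unique (V := C_R_NormedModule)). Qed.

(** Decomposing [f] along the real basis 1, i reduces complex-valued derivatives to real ones, which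
    [auto_derive] can compute. *)
Lemma is_deriveC_pair (f : R -> C) (t u v : R) :
  is_derive (fun s => fst (f s)) t u -> is_derive (fun s => snd (f s)) t v ->
  is_deriveC f t (u, v).
Proof.
  intros Hu Hv.
  apply (is_derive_ext (V := C_R_NormedModule)
           (fun s => plus (scal (fst (f s)) (1, 0) : C_R_NormedModule) (scal (snd (f s)) (0, 1)))).
  { intros s. rewrite (surjective_pairing (f s)) at 3.
    cbv [plus scal]; simpl. unfold prod_plus, prod_scal. cbv [plus scal]; simpl.
    cbv [mult]; simpl. f_equal; ring. }
  replace (u, v) with (plus (scal u (1, 0) : C_R_NormedModule) (scal v (0, 1))).
  2: { cbv [plus scal]; simpl. unfold prod_plus, prod_scal. cbv [plus scal]; simpl.
    cbv [mult]; simpl. f_equal; ring. }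
  apply (is_derive_plus (V := C_R_NormedModule)); apply (is_derive_scal_l (V := C_R_NormedModule)); assumption.
Qed.

Lemma is_deriveC_fst (f : R -> C) (t : R) (l : C) :
  is_deriveC f t l -> is_derive (fun s => fst (f s)) t (fst l).
Proof.
  intros H.
  apply (filterdiff_comp' f (fun z : C_R_NormedModule => fst z) t
           (fun y : R => scal y (l : C_R_NormedModule)) (fun z : C_R_NormedModule => fst z)).
  - exact H.
  - apply filterdiff_linear, (is_linear_fst (U := R_NormedModule) (V := R_NormedModule)).
Qed.

Lemma is_deriveC_snd (f : R -> C) (t : R) (l : C) :
  is_deriveC f t l -> is_derive (fun s => snd (f s)) t (snd l).
Proof.
  intros H.
  apply (filterdiff_comp' f (fun z : C_R_NormedModule => snd z) t
           (fun y : R => scal y (l : C_R_NormedModule)) (fun z : C_R_NormedModule => snd z)).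
  - exact H.
  - apply filterdiff_linear, (is_linear_snd (U := R_NormedModule) (V := R_NormedModule)).
Qed.

Lemma is_deriveC_RtoC (f : R -> R) (t l : R) :
  is_derive f t l -> is_deriveC (fun s => RtoC (f s)) t (RtoC l).
Proof.
  intros H. apply is_deriveC_pair; [exact H|].
  apply (is_derive_const (V := R_NormedModule) 0 t).
Qed.

Lemma is_deriveC_const (c : C) (t : R) : is_deriveC (fun _ => c) t (RtoC 0).
Proof. apply (is_derive_const (V := C_R_NormedModule)). Qed.

Lemma is_deriveC_plus (f g : R -> C) (t : R) (f' g' : C) :
  is_deriveC f t f' -> is_deriveC g t g' ->
  is_deriveC (fun s => f s + g s)%C t (f' + g')%C.
Proof. apply (is_derive_plus (V := C_R_NormedModule)). Qed.

Lemma is_deriveC_minus (f g : R -> C) (t : R) (f' g' : C) :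
  is_deriveC f t f' -> is_deriveC g t g' ->
  is_deriveC (fun s => f s - g s)%C t (f' - g')%C.
Proof. apply (is_derive_minus (V := C_R_NormedModule)). Qed.

Lemma is_deriveC_mult (f g : R -> C) (t : R) (f' g' : C) :
  is_deriveC f t f' -> is_deriveC g t g' ->
  is_deriveC (fun s => f s * g s)%C t (f' * g t + f t * g')%C.
Proof.
  intros Hf Hg.
  assert (Hf1 := is_deriveC_fst _ _ _ Hf). assert (Hf2 := is_deriveC_snd _ _ _ Hf).
  assert (Hg1 := is_deriveC_fst _ _ _ Hg). assert (Hg2 := is_deriveC_snd _ _ _ Hg).
  assert (M : forall u v : R -> R, forall u' v' : R, is_derive u t u' -> is_derive v t v' ->
            is_derive (fun s => u s * v s) t (u' * v t + u t * v')).
  { intros u v u' v' Hu Hv.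
    apply (is_derive_mult (K := R_AbsRing)); try assumption. intros; apply Rmult_comm. }
  rewrite (surjective_pairing (f' * g t + f t * g')%C).
  apply is_deriveC_pair; simpl.
  - match goal with |- is_derive _ _ ?l =>
      replace l with ((fst f' * fst (g t) + fst (f t) * fst g')
                      - (snd f' * snd (g t) + snd (f t) * snd g')) by ring end.
    apply (is_derive_minus (V := R_NormedModule)).
    + now apply (M (fun s => fst (f s)) (fun s => fst (g s))).
    + now apply (M (fun s => snd (f s)) (fun s => snd (g s))).
  - match goal with |- is_derive _ _ ?l =>
      replace l with ((fst f' * snd (g t) + fst (f t) * snd g')
                      + (snd f' * fst (g t) + snd (f t) * fst g')) by ring end.
    apply (is_derive_plus (V := R_NormedModule)).
    + now apply (M (fun s => fst (f s)) (fun s => snd (g s))).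
    + now apply (M (fun s => snd (f s)) (fun s => fst (g s))).
Qed.

Lemma is_deriveC_comp (f : R -> C) (g : R -> R) (t g' : R) (f' : C) :
  is_deriveC f (g t) f' -> is_derive g t g' ->
  is_deriveC (fun s => f (g s)) t (RtoC g' * f')%C.
Proof.
  intros Hf Hg.
  replace (RtoC g' * f')%C with (scal g' (f' : C_R_NormedModule)).
  { apply (is_derive_comp (V := C_R_NormedModule) f g t f' g' Hf Hg). }
  destruct f' as [u v]. cbv [scal]; simpl. unfold prod_scal, Cmult, RtoC; simpl.
  cbv [scal]; simpl. cbv [mult]; simpl. f_equal; ring.
Qed.

Lemma is_deriveC_continuous (f : R -> C) (t : R) (f' : C) :
  is_deriveC f t f' -> continuous (f : R -> C_R_NormedModule) t.
Proof. intros H. apply ex_derive_continuous. exists f'. exact H. Qed.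

Lemma RtoC_nonzero (r : R) : r <> 0 -> RtoC r <> RtoC 0.
Proof. intros H E. apply H. exact (RtoC_inj _ _ E). Qed.

(** * Complex exponential and principal powers of a positive base *)

Lemma Cexp_plus (z w : C) : Cexp (z + w)%C = (Cexp z * Cexp w)%C.
Proof.
  destruct z as [a b], w as [c d]. unfold Cexp, Cmult, Cplus; simpl.
  rewrite exp_plus, cos_plus, sin_plus. f_equal; ring.
Qed.

Lemma Cexp_RtoC (r : R) : Cexp (RtoC r) = RtoC (exp r).
Proof. unfold Cexp, RtoC; simpl. rewrite cos_0, sin_0. f_equal; ring. Qed.

Lemma Cmod_Cexp (z : C) : Cmod (Cexp z) = exp (Re z).
Proof.
  unfold Cmod, Cexp; simpl. rewrite !Rmult_1_r.
  generalize (sin2_cos2 (Im z)) (exp_pos (Re z)); unfold Rsqr; intros H H0.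
  transitivity (sqrt (exp (Re z) * exp (Re z))).
  - f_equal. transitivity (exp (Re z) * exp (Re z) *
      (sin (Im z) * sin (Im z) + cos (Im z) * cos (Im z))); [ring|rewrite H; ring].
  - apply sqrt_square; lra.
Qed.

Lemma Rcpow_plus (c : R) (z w : C) : Rcpow c (z + w)%C = (Rcpow c z * Rcpow c w)%C.
Proof. unfold Rcpow. rewrite <- Cexp_plus. f_equal. ring. Qed.

Lemma Rcpow_0 (c : R) : Rcpow c (RtoC 0) = RtoC 1.
Proof. unfold Rcpow. rewrite Cmult_0_l, Cexp_RtoC, exp_0. reflexivity. Qed.

Lemma Cmod_Rcpow (c : R) (z : C) : Cmod (Rcpow c z) = Rpower c (Re z).
Proof.
  unfold Rcpow. rewrite Cmod_Cexp. unfold Rpower. f_equal.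
  destruct z; simpl; ring.
Qed.

Lemma Rcpow_nonzero (c : R) (z : C) : Rcpow c z <> RtoC 0.
Proof.
  apply Cmod_gt_0. rewrite Cmod_Rcpow. apply exp_pos.
Qed.

Lemma Rcpow_opp (c : R) (z : C) : Rcpow c (- z)%C = (/ Rcpow c z)%C.
Proof.
  assert (H := Rcpow_nonzero c z).
  assert (E : (Rcpow c (- z) * Rcpow c z)%C = RtoC 1).
  { rewrite <- Rcpow_plus, <- (Rcpow_0 c). f_equal. ring. }
  rewrite <- (Cmult_1_l (/ Rcpow c z)), <- E. field. exact H.
Qed.

Lemma Rcpow_minus (c : R) (z w : C) : Rcpow c (z - w)%C = (Rcpow c z / Rcpow c w)%C.
Proof. unfold Cminus. now rewrite Rcpow_plus, Rcpow_opp. Qed.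

Lemma Rcpow_RtoC (c r : R) : Rcpow c (RtoC r) = RtoC (Rpower c r).
Proof. unfold Rcpow. now rewrite <- RtoC_mult, Cexp_RtoC. Qed.

Lemma Rcpow_1 (c : R) : 0 < c -> Rcpow c (RtoC 1) = RtoC c.
Proof. intros H. now rewrite Rcpow_RtoC, Rpower_1. Qed.

Lemma Rcpow_mult_base (c d : R) (z : C) :
  0 < c -> 0 < d -> Rcpow (c * d) z = (Rcpow c z * Rcpow d z)%C.
Proof.
  intros Hc Hd. unfold Rcpow. rewrite <- Cexp_plus, ln_mult, RtoC_plus by assumption.
  f_equal. ring.
Qed.

Lemma Rcpow_div_base (c d : R) (z : C) :
  0 < c -> 0 < d -> Rcpow (c / d) z = (Rcpow c z / Rcpow d z)%C.
Proof.
  intros Hc Hd. assert (H := Rcpow_nonzero d z).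
  replace (Rcpow c z) with (Rcpow (c / d * d) z).
  - rewrite Rcpow_mult_base by (try apply Rdiv_lt_0_compat; assumption). now field.
  - f_equal. field. lra.
Qed.

Lemma Rcpow_Rpower (c r : R) (z : C) : Rcpow (Rpower c r) z = Rcpow c (RtoC r * z)%C.
Proof. unfold Rcpow, Rpower. rewrite ln_exp, RtoC_mult. f_equal. ring. Qed.

Lemma is_deriveC_Rcpow (t : R) (z : C) :
  0 < t -> is_deriveC (fun s => Rcpow s z) t (z * Rcpow t (z - 1))%C.
Proof.
  intros Ht.
  replace (z * Rcpow t (z - 1))%C with (Rcpow t z * (z * RtoC (/ t)))%C.
  2: { rewrite Rcpow_minus, Rcpow_1 by exact Ht. rewrite RtoC_inv by lra. field.
       apply RtoC_nonzero. lra. }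
  destruct z as [a b].
  unfold Rcpow, Cexp, Cmult, RtoC; simpl.
  apply is_deriveC_pair; simpl; auto_derive; try (repeat split; lra);
    unfold Rminus; rewrite !Rmult_0_r, ?Ropp_0, !Rplus_0_r, !Rplus_0_l; ring.
Qed.

(** * Improper integrals *)

(** The fundamental theorem applies on each compact interval inside the order-convex set [D], and
    the difference of endpoint values passes to the limit. Keeping the filters abstract covers both
    (0,1) and the half line; [Rmin] and [Rmax] occur because a product filter does not order its two
    points. *)
Lemma is_RInt_gen_primitive {V : CompleteNormedModule R_AbsRing}
  (Fa Fb : (R -> Prop) -> Prop) {FFa : Filter Fa} {FFb : Filter Fb}
  (D : R -> Prop) (F f : R -> V) (la lb : V) :
  (forall u v w, D u -> D v -> u <= w <= v -> D w) ->
  Fa D -> Fb D ->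
  (forall t, D t -> is_derive F t (f t)) -> (forall t, D t -> continuous f t) ->
  filterlim F Fa (locally la) -> filterlim F Fb (locally lb) ->
  is_RInt_gen f Fa Fb (minus lb la).
Proof.
  intros HD Ha Hb HF Hf Hla Hlb.
  assert (Hmid : forall u v w, D u -> D v -> Rmin u v <= w <= Rmax u v -> D w).
  { intros u v w Hu Hv. unfold Rmin, Rmax. destruct (Rle_dec u v); apply HD; assumption. }
  apply (filterlimi_lim_ext_loc (fun ab : R * R => minus (F (snd ab)) (F (fst ab)))).
  - apply (Filter_prod _ _ _ D D); try assumption. intros u v Hu Hv. simpl.
    apply (is_RInt_derive F f u v); intros w Hw; [apply HF|apply Hf];
      exact (Hmid u v w Hu Hv Hw).
  - apply (filterlim_comp_2 (F := filter_prod Fa Fb) (G := locally lb) (H := locally (opp la))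
             (fun ab : R * R => F (snd ab)) (fun ab => opp (F (fst ab))) plus).
    + apply filterlim_comp with (2 := Hlb). apply filterlim_snd.
    + apply filterlim_comp with (g := opp) (G := locally la).
      * apply filterlim_comp with (2 := Hla). apply filterlim_fst.
      * apply (filterlim_opp (K := R_AbsRing) (V := V) la).
    + apply (filterlim_plus (K := R_AbsRing) (V := V) lb (opp la)).
Qed.

Lemma is_RInt_gen_linear {U V : NormedModule R_AbsRing}
  (Fa Fb : (R -> Prop) -> Prop) {FFa : Filter Fa} {FFb : Filter Fb}
  (L : U -> V) (f : R -> U) (l : U) :
  (forall a b m, is_RInt f a b m -> is_RInt (fun t => L (f t)) a b (L m)) ->
  continuous L l ->
  is_RInt_gen f Fa Fb l -> is_RInt_gen (fun t => L (f t)) Fa Fb (L l).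
Proof.
  intros HL Hc Hf P HP. unfold filtermapi.
  generalize (Hf _ (Hc P HP)). unfold filtermapi.
  apply filter_imp. intros [a b] [m [Hm HPm]]. exists (L m). split; [now apply HL|exact HPm].
Qed.

(** [scal] on [C_R_NormedModule] accepts only real scalars, so multiplication by a complex constant
    is treated as a continuous real-linear map, coordinate by coordinate. *)
Lemma is_RInt_gen_C_scal (Fa Fb : (R -> Prop) -> Prop) {FFa : Filter Fa} {FFb : Filter Fb}
  (c : C) (f : R -> C) (l : C) :
  is_RInt_gen (V := C_R_NormedModule) f Fa Fb l ->
  is_RInt_gen (V := C_R_NormedModule) (fun t => c * f t)%C Fa Fb (c * l)%C.
Proof.
  apply (is_RInt_gen_linear (U := C_R_NormedModule) (V := C_R_NormedModule) Fa Fb (fun z : C => (c * z)%C)).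
  - intros a b m Hm.
    assert (H1 := is_RInt_fct_extend_fst (U := R_NormedModule) (V := R_NormedModule) _ _ _ _ Hm).
    assert (H2 := is_RInt_fct_extend_snd (U := R_NormedModule) (V := R_NormedModule) _ _ _ _ Hm).
    apply (is_RInt_fct_extend_pair (U := R_NormedModule) (V := R_NormedModule)).
    + apply (is_RInt_minus (V := R_NormedModule));
        apply (is_RInt_scal (V := R_NormedModule)); assumption.
    + apply (is_RInt_plus (V := R_NormedModule));
        apply (is_RInt_scal (V := R_NormedModule)); assumption.
  - apply (filterlim_C_mult (locally l) (fun _ => c) (fun z => z)).
    + apply filterlim_const.
    + apply filterlim_id.
Qed.

Lemma is_RInt_gen_Re (Fa Fb : (R -> Prop) -> Prop) {FFa : Filter Fa} {FFb : Filter Fb}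
  (f : R -> C) (l : C) :
  is_RInt_gen (V := C_R_NormedModule) f Fa Fb l ->
  is_RInt_gen (fun t => Re (f t)) Fa Fb (Re l).
Proof.
  apply (is_RInt_gen_linear (U := C_R_NormedModule) (V := R_NormedModule) Fa Fb Re).
  - intros a b m Hm.
    exact (is_RInt_fct_extend_fst (U := R_NormedModule) (V := R_NormedModule) _ _ _ _ Hm).
  - apply (continuous_fst (U := R_UniformSpace) (V := R_UniformSpace)).
Qed.

(** Increments of [F] are bounded by those of [G], and [G] converges, so [F] satisfies the Cauchy
    criterion along [Fl]; completeness of C supplies the limit. *)
Lemma primitive_limit_of_dominated (Fl : (R -> Prop) -> Prop) {FF : ProperFilter Fl}
  (D : R -> Prop) (F f : R -> C) (G g : R -> R) (l : R) :
  (forall u v w, D u -> D v -> u <= w <= v -> D w) -> Fl D ->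
  (forall t, D t -> is_deriveC F t (f t)) ->
  (forall t, D t -> continuous (f : R -> C_R_NormedModule) t) ->
  (forall t, D t -> is_derive G t (g t)) -> (forall t, D t -> continuous g t) ->
  (forall t, D t -> Cmod (f t) <= g t) ->
  filterlim G Fl (locally l) -> exists m : C, filterlim F Fl (locally m).
Proof.
  intros HD HFl HF Hf HG Hg Hle Hl.
  assert (key : forall u v, D u -> D v -> u <= v -> Cmod (F v - F u) <= G v - G u).
  { intros u v Hu Hv Huv. rewrite <- C_R_norm.
    apply (norm_RInt_le (V := C_R_NormedModule) f g u v); trivial.
    - intros t Ht. rewrite C_R_norm. apply Hle. exact (HD u v t Hu Hv Ht).
    - apply (is_RInt_derive (V := C_R_CompleteNormedModule));
        rewrite Rmin_left, Rmax_right by assumption; intros t Ht;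
        [apply HF|apply Hf]; exact (HD u v t Hu Hv Ht).
    - apply (is_RInt_derive (V := R_CompleteNormedModule));
        rewrite Rmin_left, Rmax_right by assumption; intros t Ht;
        [apply HG|apply Hg]; exact (HD u v t Hu Hv Ht). }
  (* The Cauchy criterion compares two points in arbitrary order, hence the absolute value. *)
  assert (key' : forall u v, D u -> D v -> Cmod (F v - F u) <= Rabs (G v - G u)).
  { intros u v Hu Hv. destruct (Rle_dec u v) as [H|H].
    - eapply Rle_trans; [now apply key|apply Rle_abs].
    - replace (F v - F u)%C with (- (F u - F v))%C by ring.
      rewrite Cmod_opp, Rabs_minus_sym.
      eapply Rle_trans; [apply key; trivial; lra|apply Rle_abs]. }
  apply (filterlim_locally_cauchy (U := C_R_CompleteNormedModule)).
  intros eps.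
  assert (Hex : exists y : R, filterlim G Fl (locally y)) by now exists l.
  destruct (proj2 (filterlim_locally_cauchy (U := R_CompleteSpace) G) Hex eps) as [P [HP HPG]].
  exists (fun t => P t /\ D t). split; [now apply filter_and|].
  intros u v [Pu Du] [Pv Dv].
  apply C_NormedModule_mixin_compat1.
  eapply Rle_lt_trans; [now apply key'|]. exact (HPG u v Pu Pv).
Qed.

(** * The Beta integral *)

Lemma at_right_0_lt (r : R) : 0 < r -> at_right 0 (fun t => 0 < t < r).
Proof.
  intros Hr. exists (mkposreal _ Hr). intros t Ht H0. split; [exact H0|].
  change (Rabs (t - 0) < r) in Ht. rewrite Rminus_0_r, Rabs_pos_eq in Ht; lra.
Qed.

Lemma at_left_1_gt (r : R) : r < 1 -> at_left 1 (fun t => r < t < 1).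
Proof.
  intros Hr. assert (H : 0 < 1 - r) by lra.
  exists (mkposreal _ H). intros t Ht H0. split; [|exact H0].
  change (Rabs (t - 1) < 1 - r) in Ht. apply Rabs_def2 in Ht. lra.
Qed.

Lemma filterlim_one_minus_at_left : filterlim (fun t => 1 - t) (at_left 1) (at_right 0).
Proof.
  intros P [eps HP].
  assert (H : 1 - eps < 1) by (generalize (cond_pos eps); lra).
  generalize (at_left_1_gt _ H). unfold filtermap. apply filter_imp. intros t Ht. apply HP; [|lra].
  change (Rabs (1 - t - 0) < eps). rewrite Rabs_pos_eq; lra.
Qed.

Lemma filterlim_one_minus_at_right : filterlim (fun t => 1 - t) (at_right 0) (at_left 1).
Proof.
  intros P [eps HP].
  generalize (at_right_0_lt _ (cond_pos eps)). unfold filtermap.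
  apply filter_imp. intros t Ht. apply HP; [|lra].
  change (Rabs (1 - t - 1) < eps). rewrite Rabs_left; lra.
Qed.

Lemma filterlim_at_left {U : UniformSpace} (f : R -> U) (t : R) : continuous f t -> filterlim f (at_left t) (locally (f t)).
Proof. apply filterlim_filter_le_1, filter_le_within. Qed.

Lemma is_derive_Rpower (t c : R) :
  0 < t -> is_derive (fun s => Rpower s c) t (c * Rpower t (c - 1)).
Proof.
  intros Ht. replace (c * Rpower t (c - 1)) with (Rpower t c * (c * / t)).
  2: { unfold Rminus. rewrite Rpower_plus, Rpower_Ropp, Rpower_1 by exact Ht. ring. }
  unfold Rpower. auto_derive; [exact Ht|]. ring.
Qed.

Lemma continuous_Rpower (t c : R) : 0 < t -> continuous (fun s => Rpower s c) t.
Proof. intros Ht. apply (ex_derive_continuous (V := R_NormedModule)). eexists. now apply is_derive_Rpower. Qed.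

Lemma Rpower_1_base (c : R) : Rpower 1 c = 1.
Proof. unfold Rpower. now rewrite ln_1, Rmult_0_r, exp_0. Qed.

Lemma Rpower_lt_at_right_0 (c eps : R) :
  0 < c -> 0 < eps -> at_right 0 (fun t => 0 < t < 1 /\ Rpower t c < eps).
Proof.
  intros Hc He.
  generalize (filter_and (F := at_right 0) _ _ (at_right_0_lt 1 Rlt_0_1)
                (at_right_0_lt (Rpower eps (/ c)) (exp_pos _))).
  apply filter_imp. intros t [Ht1 Ht]. split; [exact Ht1|].
  replace eps with (Rpower (Rpower eps (/ c)) c).
  - apply Rlt_Rpower_l; lra.
  - rewrite Rpower_mult, Rinv_l, Rpower_1 by lra. reflexivity.
Qed.

Lemma Rpower_at_right_0 (c : R) : 0 < c -> filterlim (fun t => Rpower t c) (at_right 0) (locally 0).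
Proof.
  intros Hc. apply filterlim_locally. intros eps.
  generalize (Rpower_lt_at_right_0 c eps Hc (cond_pos eps)). apply filter_imp. intros t [_ Ht].
  change (Rabs (Rpower t c - 0) < eps).
  assert (0 < Rpower t c) by apply exp_pos.
  rewrite Rminus_0_r, Rabs_pos_eq; lra.
Qed.

Lemma exp_le_compat (u v : R) : u <= v -> exp u <= exp v.
Proof.
  intros [H|H]; [|now rewrite H]. apply Rlt_le. now apply exp_increasing.
Qed.

Lemma Rpower_le_of_half_le (s c : R) : 1 / 2 <= s <= 1 -> Rpower s c <= Rpower 2 (Rabs c).
Proof.
  intros Hs.
  assert (H1 : ln s <= 0) by (rewrite <- ln_1; apply ln_le; lra).
  assert (H2 : - ln 2 <= ln s).
  { rewrite <- ln_Rinv by lra. apply ln_le; lra. }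
  unfold Rpower. apply exp_le_compat.
  assert (H3 := Rle_abs c). assert (H4 := Rle_abs (- c)). rewrite Rabs_Ropp in H4.
  assert (H5 := Rabs_pos c).
  nra.
Qed.

Lemma is_deriveC_Rcpow_one_minus (t : R) (z : C) :
  t < 1 -> is_deriveC (fun s => Rcpow (1 - s) z) t (- (z * Rcpow (1 - t) (z - 1)))%C.
Proof.
  intros Ht.
  replace (- (z * Rcpow (1 - t) (z - 1)))%C with (RtoC (- (1)) * (z * Rcpow (1 - t) (z - 1)))%C
    by (rewrite RtoC_opp; ring).
  apply (is_deriveC_comp (fun s => Rcpow s z) (fun s => 1 - s)).
  - apply is_deriveC_Rcpow. lra.
  - auto_derive; [trivial|ring].
Qed.

Lemma continuous_beta_integrand (a b : C) (t : R) :
  0 < t < 1 -> continuous (beta_integrand a b : R -> C_R_NormedModule) t.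
Proof.
  intros Ht. eapply is_deriveC_continuous. apply is_deriveC_mult.
  - apply is_deriveC_Rcpow. lra.
  - apply is_deriveC_Rcpow_one_minus. lra.
Qed.

(** On each half of (0,1) one of the bases [t], [1 - t] lies in [1/2, 1], where its power is at most
    [2^|c|] whatever the sign of the exponent [c]. Adding the bounds of the two halves gives a
    single majorant with an elementary primitive. *)
Lemma Cmod_beta_integrand_le (a b : C) (t : R) :
  0 < t < 1 ->
  Cmod (beta_integrand a b t) <=
    Rpower 2 (Rabs (Re b - 1)) * Rpower t (Re a - 1)
    + Rpower 2 (Rabs (Re a - 1)) * Rpower (1 - t) (Re b - 1).
Proof.
  intros Ht. unfold beta_integrand.
  rewrite Cmod_mult, !Cmod_Rcpow.
  replace (Re (a - 1)) with (Re a - 1) by (destruct a; simpl; lra).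
  replace (Re (b - 1)) with (Re b - 1) by (destruct b; simpl; lra).
  assert (H1 : 0 < Rpower t (Re a - 1)) by apply exp_pos.
  assert (H2 : 0 < Rpower (1 - t) (Re b - 1)) by apply exp_pos.
  assert (H3 : 0 < Rpower 2 (Rabs (Re a - 1))) by apply exp_pos.
  assert (H4 : 0 < Rpower 2 (Rabs (Re b - 1))) by apply exp_pos.
  destruct (Rle_dec t (1 / 2)).
  - assert (H := Rpower_le_of_half_le (1 - t) (Re b - 1) ltac:(lra)). nra.
  - assert (H := Rpower_le_of_half_le t (Re a - 1) ltac:(lra)). nra.
Qed.

Lemma beta_primitive (a b : C) :
  0 < Re a -> 0 < Re b ->
  exists (F : R -> C) (l0 l1 : C),
    (forall t, 0 < t < 1 -> is_deriveC F t (beta_integrand a b t)) /\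
    filterlim F (at_right 0) (locally l0) /\ filterlim F (at_left 1) (locally l1).
Proof.
  intros Ha Hb.
  set (f := beta_integrand a b : R -> C_R_CompleteNormedModule).
  (* The base point is interior because the integrand may be unbounded at both endpoints. *)
  set (F := fun t => RInt f (1 / 2) t).
  assert (HF : forall t, 0 < t < 1 -> is_deriveC F t (f t)).
  { intros t Ht. apply (is_derive_RInt (V := C_R_NormedModule) f F (1 / 2) t).
    - apply (locally_interval _ t 0 1); simpl; try lra. intros s H0 H1.
      apply (RInt_correct (V := C_R_CompleteNormedModule)).
      apply (ex_RInt_continuous (V := C_R_CompleteNormedModule)).
      intros z Hz. apply continuous_beta_integrand.
      revert Hz; unfold Rmin, Rmax; destruct (Rle_dec (1 / 2) s); lra.
    - now apply continuous_beta_integrand. }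
  set (m0 := Rpower 2 (Rabs (Re b - 1))). set (m1 := Rpower 2 (Rabs (Re a - 1))).
  (* Explicit primitive of the majorant; it has finite limits at 0 and 1 exactly because [Re a] and
     [Re b] are positive. *)
  set (G := fun t => m0 / Re a * Rpower t (Re a) - m1 / Re b * Rpower (1 - t) (Re b)).
  set (g := fun t => m0 * Rpower t (Re a - 1) + m1 * Rpower (1 - t) (Re b - 1)).
  assert (HG : forall t, 0 < t < 1 -> is_derive G t (g t)).
  { intros t Ht.
    assert (H1 := is_derive_Rpower t (Re a) ltac:(lra)).
    assert (H2 : is_derive (fun s => Rpower (1 - s) (Re b)) t (-1 * (Re b * Rpower (1 - t) (Re b - 1)))).
    { apply (is_derive_comp (V := R_NormedModule) (fun s => Rpower s (Re b)) (fun s => 1 - s)).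
      - apply is_derive_Rpower; lra.
      - auto_derive; [trivial|ring]. }
    replace (g t) with (m0 / Re a * (Re a * Rpower t (Re a - 1))
      - m1 / Re b * (-1 * (Re b * Rpower (1 - t) (Re b - 1)))) by (unfold g; field; lra).
    apply (is_derive_minus (V := R_NormedModule));
      apply is_derive_scal; assumption. }
  assert (Hg : forall t, 0 < t < 1 -> continuous g t).
  { intros t Ht. apply (continuous_plus (V := R_NormedModule));
      apply (continuous_scal_r (V := R_NormedModule)).
    - apply continuous_Rpower; lra.
    - apply (continuous_comp (fun s => 1 - s) (fun s => Rpower s (Re b - 1))).
      + apply (ex_derive_continuous (V := R_NormedModule)). auto_derive; trivial.
      + apply continuous_Rpower; lra. }
  assert (lin : forall (Fl : (R -> Prop) -> Prop) (HFl : Filter Fl) c d (u v : R -> R) lu lv,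
    filterlim u Fl (locally lu) -> filterlim v Fl (locally lv) ->
    filterlim (fun t => c * u t - d * v t) Fl (locally (c * lu - d * lv))).
  { intros Fl HFl c d u v lu lv Hu Hv.
    apply (filterlim_comp_2 (G := locally (c * lu)) (H := locally (opp (d * lv))) (fun t => c * u t) (fun t => opp (d * v t)) plus).
    - apply filterlim_comp with (1 := Hu). apply (filterlim_scal_r (V := R_NormedModule)).
    - apply filterlim_comp with (g := opp) (G := locally (d * lv)).
      + apply filterlim_comp with (1 := Hv). apply (filterlim_scal_r (V := R_NormedModule)).
      + apply (filterlim_opp (V := R_NormedModule)).
    - apply (filterlim_plus (V := R_NormedModule)). }
  assert (HD : forall u v w, 0 < u < 1 -> 0 < v < 1 -> u <= w <= v -> 0 < w < 1) by (intros; lra).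
  assert (H0 : at_right 0 (fun t => 0 < t < 1)) by (apply at_right_0_lt; lra).
  assert (H1 : at_left 1 (fun t => 0 < t < 1)) by (apply at_left_1_gt; lra).
  assert (C1 : forall c, filterlim (fun t => Rpower t c) (at_left 1) (locally 1)).
  { intros c. rewrite <- (Rpower_1_base c) at 2. apply (filterlim_at_left (U := R_UniformSpace) (fun t => Rpower t c)).
    apply continuous_Rpower; lra. }
  destruct (primitive_limit_of_dominated (at_right 0) _ F f G g
    (m0 / Re a * 0 - m1 / Re b * 1) HD H0 HF
    (continuous_beta_integrand a b) HG Hg (Cmod_beta_integrand_le a b)) as [l0 Hl0].
  { apply lin; [typeclasses eauto| |].
    - now apply Rpower_at_right_0.
    - eapply (filterlim_comp _ _ _ (fun t => 1 - t) (fun t => Rpower t (Re b)));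
        [apply filterlim_one_minus_at_right|apply C1]. }
  destruct (primitive_limit_of_dominated (at_left 1) _ F f G g
    (m0 / Re a * 1 - m1 / Re b * 0) HD H1 HF
    (continuous_beta_integrand a b) HG Hg (Cmod_beta_integrand_le a b)) as [l1 Hl1].
  { apply lin; [typeclasses eauto| |].
    - apply C1.
    - eapply (filterlim_comp _ _ _ (fun t => 1 - t) (fun t => Rpower t (Re b)));
        [apply filterlim_one_minus_at_left|now apply Rpower_at_right_0]. }
  exists F, l0, l1. split; [|split]; assumption.
Qed.

(** A relation rather than the total [Beta], so that each value carries the convergence of its
    integral. *)
Definition is_beta (a b B : C) : Prop :=
  is_RInt_gen (V := C_R_NormedModule) (beta_integrand a b) (at_right 0) (at_left 1) B.

Lemma is_RInt_gen_01_primitive (F f : R -> C) (l0 l1 : C) :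
  (forall t, 0 < t < 1 -> is_deriveC F t (f t)) ->
  (forall t, 0 < t < 1 -> continuous (f : R -> C_R_NormedModule) t) ->
  filterlim F (at_right 0) (locally l0) -> filterlim F (at_left 1) (locally l1) ->
  is_RInt_gen (V := C_R_NormedModule) f (at_right 0) (at_left 1) (l1 - l0)%C.
Proof.
  intros HF Hf H0 H1.
  refine (is_RInt_gen_primitive (V := C_R_CompleteNormedModule) (at_right 0) (at_left 1)
           (fun t => 0 < t < 1) F f l0 l1 _ _ _ HF Hf H0 H1).
  - intros; lra.
  - apply at_right_0_lt; lra.
  - apply at_left_1_gt; lra.
Qed.

Lemma is_beta_of_primitive (a b : C) (F : R -> C) (l0 l1 : C) :
  (forall t, 0 < t < 1 -> is_deriveC F t (beta_integrand a b t)) ->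
  filterlim F (at_right 0) (locally l0) -> filterlim F (at_left 1) (locally l1) ->
  is_beta a b (l1 - l0)%C.
Proof.
  intros HF. apply (is_RInt_gen_01_primitive F _ l0 l1 HF), continuous_beta_integrand.
Qed.

Lemma is_beta_exists (a b : C) : 0 < Re a -> 0 < Re b -> exists B, is_beta a b B.
Proof.
  intros Ha Hb. destruct (beta_primitive a b Ha Hb) as (F & l0 & l1 & HF & H0 & H1).
  eexists. eapply is_beta_of_primitive; eassumption.
Qed.

Lemma is_RInt_gen_C_unique (Fa Fb : (R -> Prop) -> Prop) {FFa : ProperFilter' Fa} {FFb : ProperFilter' Fb}
  (f : R -> C) (l m : C) :
  is_RInt_gen (V := C_R_NormedModule) f Fa Fb l ->
  is_RInt_gen (V := C_R_NormedModule) f Fa Fb m -> l = m.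
Proof.
  intros Hl Hm.
  apply (is_RInt_gen_unique (V := C_R_CompleteNormedModule)) in Hl, Hm. congruence.
Qed.

(** * Recurrence in the second parameter and values at integers *)

Lemma Rcpow_mult_at_right_0 (a b : C) :
  0 < Re a -> 0 < Re b ->
  filterlim (fun t => Rcpow t a * Rcpow (1 - t) b)%C (at_right 0) (locally (RtoC 0)).
Proof.
  intros Ha Hb. apply filterlim_Cmod; [typeclasses eauto|]. intros eps He.
  generalize (Rpower_lt_at_right_0 (Re a) eps Ha He).
  apply filter_imp. intros t [Ht Hlt].
  assert (0 < Rpower t (Re a)) by apply exp_pos.
  replace (Rcpow t a * Rcpow (1 - t) b - 0)%C with (Rcpow t a * Rcpow (1 - t) b)%C by ring.
  rewrite Cmod_mult, !Cmod_Rcpow.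
  assert (0 < Rpower (1 - t) (Re b)) by apply exp_pos.
  assert (Rpower (1 - t) (Re b) <= Rpower 1 (Re b)) by (apply Rle_Rpower_l; lra).
  rewrite Rpower_1_base in *. nra.
Qed.

Lemma Re_plus (z w : C) : Re (z + w)%C = Re z + Re w.
Proof. reflexivity. Qed.

Lemma C_nonzero_of_Re (z : C) : 0 < Re z -> z <> RtoC 0.
Proof. intros H E. rewrite E in H. simpl in H. lra. Qed.

(* [(t^a (1-t)^b)' = (a+b) t^(a-1) (1-t)^b - b t^(a-1) (1-t)^(b-1)], and the
   boundary terms vanish. *)
Lemma is_beta_shift (a b B : C) :
  0 < Re a -> 0 < Re b -> is_beta a b B -> is_beta a (b + 1)%C (b / (a + b) * B)%C.
Proof.
  intros Ha Hb HB.
  destruct (is_beta_exists a (b + 1)%C Ha) as [B1 HB1]; [rewrite Re_plus; simpl; lra|].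
  assert (Hab : (a + b)%C <> RtoC 0) by (apply C_nonzero_of_Re; rewrite Re_plus; lra).
  enough (E : ((a + b) * B1 - b * B)%C = RtoC 0).
  { replace (b / (a + b) * B)%C with B1; [exact HB1|].
    replace B1 with (((a + b) * B1 - b * B) / (a + b) + b / (a + b) * B)%C by (field; exact Hab).
    rewrite E. field. exact Hab. }
  set (df := fun t => ((a + b) * beta_integrand a (b + 1) t - b * beta_integrand a b t)%C).
  (* The integral of [df] is evaluated twice: by linearity from [B1] and [B], and from the boundary
     values of its primitive, which are both zero. *)
  apply (is_RInt_gen_C_unique (at_right 0) (at_left 1) df).
  - apply (is_RInt_gen_minus (V := C_R_NormedModule));
      apply is_RInt_gen_C_scal; try typeclasses eauto; assumption.
  - replace (RtoC 0) with (RtoC 0 - RtoC 0)%C by ring.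
    apply (is_RInt_gen_01_primitive (fun t => Rcpow t a * Rcpow (1 - t) b)%C).
    + intros t Ht.
      replace (df t) with ((a * Rcpow t (a - 1)) * Rcpow (1 - t) b
         + Rcpow t a * - (b * Rcpow (1 - t) (b - 1)))%C.
      { apply is_deriveC_mult; [apply is_deriveC_Rcpow|apply is_deriveC_Rcpow_one_minus]; lra. }
      unfold df, beta_integrand.
      replace (b + 1 - 1)%C with (b - 1 + 1)%C by ring.
      replace (Rcpow t a) with (Rcpow t (a - 1 + 1)%C) by (f_equal; ring).
      replace (Rcpow (1 - t) b) with (Rcpow (1 - t) (b - 1 + 1)%C) by (f_equal; ring).
      rewrite (Rcpow_plus t (a - 1)), (Rcpow_plus (1 - t) (b - 1)).
      rewrite !Rcpow_1 by lra. rewrite RtoC_minus. ring.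
    + intros t Ht. apply (continuous_minus (V := C_R_NormedModule)).
      * eapply is_deriveC_continuous. apply is_deriveC_mult; [apply is_deriveC_const|].
        apply is_deriveC_mult; [apply is_deriveC_Rcpow|apply is_deriveC_Rcpow_one_minus]; lra.
      * eapply is_deriveC_continuous. apply is_deriveC_mult; [apply is_deriveC_const|].
        apply is_deriveC_mult; [apply is_deriveC_Rcpow|apply is_deriveC_Rcpow_one_minus]; lra.
    + now apply Rcpow_mult_at_right_0.
    (* Reflecting [t] to [1 - t] exchanges [a] and [b], so the boundary term at 1 is an instance of
       the one at 0. *)
    + apply filterlim_ext with (fun t => Rcpow (1 - t) b * Rcpow (1 - (1 - t)) a)%C.
      { intros t. replace (1 - (1 - t)) with t by ring. ring. }
      apply (filterlim_comp _ _ _ (fun t => 1 - t) (fun t => Rcpow t b * Rcpow (1 - t) a)%C _ (at_right 0)).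
      * apply filterlim_one_minus_at_left.
      * now apply Rcpow_mult_at_right_0.
Qed.

Lemma is_beta_one (a : C) : 0 < Re a -> is_beta a 1 (/ a)%C.
Proof.
  intros Ha. assert (Ha0 := C_nonzero_of_Re a Ha).
  replace (/ a)%C with (/ a * 1 - / a * 0)%C by ring.
  apply (is_beta_of_primitive a 1 (fun t => / a * Rcpow t a)%C).
  - intros t Ht.
    replace (beta_integrand a 1 t) with (RtoC 0 * Rcpow t a + / a * (a * Rcpow t (a - 1)))%C.
    + apply is_deriveC_mult; [apply is_deriveC_const|apply is_deriveC_Rcpow; lra].
    + unfold beta_integrand. replace (1 - 1)%C with (RtoC 0) by ring.
      rewrite Rcpow_0. field. exact Ha0.
  - apply filterlim_C_mult; [typeclasses eauto|apply filterlim_const|].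
    apply filterlim_Cmod; [typeclasses eauto|]. intros eps He.
    generalize (Rpower_lt_at_right_0 (Re a) eps Ha He).
    apply filter_imp. intros t [_ Hlt].
    replace (Rcpow t a - 0)%C with (Rcpow t a) by ring. now rewrite Cmod_Rcpow.
  - apply filterlim_C_mult; [typeclasses eauto|apply filterlim_const|].
    replace (RtoC 1) with (Rcpow 1 a).
    + apply (filterlim_at_left (U := C_R_NormedModule) (fun t => Rcpow t a)).
      eapply (is_deriveC_continuous (fun t => Rcpow t a)). apply is_deriveC_Rcpow; lra.
    + unfold Rcpow. rewrite ln_1, Cmult_0_r, Cexp_RtoC, exp_0. reflexivity.
Qed.

Fixpoint rising (a : C) (n : nat) : C :=
  match n with
  | O => RtoC 1
  | S m => (rising a m * (a + INR m))%C
  end.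

Lemma Re_plus_INR (a : C) (n : nat) : 0 < Re a -> 0 < Re (a + INR n)%C.
Proof. intros H. rewrite Re_plus. simpl. generalize (pos_INR n). lra. Qed.

Lemma rising_nonzero (a : C) (n : nat) : 0 < Re a -> rising a n <> RtoC 0.
Proof.
  intros Ha. induction n as [|n IH]; simpl.
  - apply RtoC_nonzero; lra.
  - apply Cmult_neq_0; [exact IH|]. now apply C_nonzero_of_Re, Re_plus_INR.
Qed.

Lemma rising_S_left (a : C) (n : nat) : rising a (S n) = (a * rising (a + 1) n)%C.
Proof.
  induction n as [|n IH].
  - simpl. ring.
  - change (rising a (S (S n))) with (rising a (S n) * (a + INR (S n)))%C.
    rewrite IH, S_INR, RtoC_plus. simpl. ring.
Qed.

Lemma rising_one (n : nat) : rising 1 n = RtoC (INR (fact n)).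
Proof.
  induction n as [|n IH]; [reflexivity|].
  simpl rising. rewrite IH, <- RtoC_plus, <- RtoC_mult. f_equal.
  rewrite fact_simpl, mult_INR, S_INR. ring.
Qed.

Lemma is_beta_shift_n (a b B : C) (n : nat) :
  0 < Re a -> 0 < Re b -> is_beta a b B ->
  is_beta a (b + INR n)%C (rising b n / rising (a + b) n * B)%C.
Proof.
  intros Ha Hb HB. induction n as [|n IH].
  - simpl. replace (b + 0)%C with b by ring.
    replace (1 / 1 * B)%C with B by (field; apply RtoC_nonzero; lra). exact HB.
  - apply is_beta_shift in IH; [|exact Ha|now apply Re_plus_INR].
    replace (b + INR (S n))%C with (b + INR n + 1)%C by (rewrite S_INR, RtoC_plus; ring).
    match goal with |- is_beta _ _ ?X => match type of IH with is_beta _ _ ?Y =>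
      replace X with Y; [exact IH|] end end.
    simpl rising.
    assert (Hab : 0 < Re (a + b)%C) by (rewrite Re_plus; lra).
    assert (H1 := rising_nonzero (a + b) n Hab).
    assert (H2 := C_nonzero_of_Re _ (Re_plus_INR (a + b) n Hab)).
    replace (a + (b + INR n))%C with (a + b + INR n)%C by ring.
    field. split; assumption.
Qed.

(** Shifting B(a, 1) = 1/a by [n] gives n! / ((a+1)...(a+n) a), and the stray factor [a] completes
    the rising factorial to length [S n]. Up to the factor n^a this is [gauss a n]. *)
Lemma is_beta_nat (a : C) (n : nat) :
  0 < Re a -> is_beta a (1 + INR n)%C (INR (fact n) / rising a (S n))%C.
Proof.
  intros Ha.
  assert (H := is_beta_shift_n a 1 (/ a)%C n Ha ltac:(simpl; lra) (is_beta_one a Ha)).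
  rewrite rising_one in H. rewrite rising_S_left.
  replace (INR (fact n) / (a * rising (a + 1) n))%C
    with (INR (fact n) / rising (a + 1) n * / a)%C; [exact H|].
  field. split; [|now apply C_nonzero_of_Re].
  apply rising_nonzero. rewrite Re_plus. simpl. lra.
Qed.

(** * Comparison of Beta integrals and the Gauss product *)

(** The mean value theorem fails for complex values; the inequality comes from bounding the integral
    of the derivative. *)
Lemma C_mean_value (F f : R -> C) (M : R) :
  (forall s, 0 <= s <= 1 -> is_deriveC F s (f s)) ->
  (forall s, 0 <= s <= 1 -> continuous (f : R -> C_R_NormedModule) s) ->
  (forall s, 0 <= s <= 1 -> Cmod (f s) <= M) ->
  Cmod (F 1 - F 0) <= M.
Proof.
  intros HF Hf HM. rewrite <- C_R_norm.
  replace M with (scal (1 - 0) M) by (cbv [scal]; simpl; cbv [mult]; simpl; ring).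
  apply (norm_RInt_le (V := C_R_NormedModule) f (fun _ => M) 0 1); try lra.
  - intros s Hs. rewrite C_R_norm. now apply HM.
  - apply (is_RInt_derive (V := C_R_CompleteNormedModule));
      rewrite Rmin_left, Rmax_right by lra; assumption.
  - apply (is_RInt_const (V := R_NormedModule)).
Qed.

Lemma is_deriveC_Cexp_ray (z : C) (s : R) :
  is_deriveC (fun s => Cexp (s * z)%C) s (z * Cexp (s * z))%C.
Proof.
  destruct z as [a b]. unfold Cexp, Cmult, RtoC; simpl.
  apply is_deriveC_pair; simpl; auto_derive; trivial; unfold Rminus;
    rewrite ?Rmult_0_l, ?Rmult_0_r, ?Ropp_0, ?Rplus_0_r, ?Rplus_0_l; ring.
Qed.

(** On the segment from 0 to [z] the real part stays nonpositive, so the exponential has modulus at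
    most 1 and the derivative modulus at most [Cmod z]. *)
Lemma Cmod_Cexp_sub_1 (z : C) : Re z <= 0 -> Cmod (Cexp z - 1) <= Cmod z.
Proof.
  intros Hz.
  replace (Cexp z - 1)%C with (Cexp (1 * z) - Cexp (0 * z))%C.
  2: { rewrite Cmult_1_l, Cmult_0_l, Cexp_RtoC, exp_0. reflexivity. }
  apply (C_mean_value (fun s : R => Cexp (s * z)) (fun s : R => z * Cexp (s * z))%C).
  - intros s _. apply is_deriveC_Cexp_ray.
  - intros s _. eapply is_deriveC_continuous.
    apply is_deriveC_mult; [apply is_deriveC_const|apply is_deriveC_Cexp_ray].
  - intros s Hs. rewrite Cmod_mult, Cmod_Cexp.
    assert (Re (s * z)%C <= 0) by (destruct z; simpl in *; nra).
    assert (exp (Re (s * z)%C) <= 1) by (rewrite <- exp_0; now apply exp_le_compat).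
    generalize (Cmod_ge_0 z). nra.
Qed.

(** The derivative of [Cexp (s z) - s z] in [s] is [z (Cexp (s z) - 1)], to which the first-order
    bound applies. Taking the supremum over [s] gives the constant 1 in place of the sharper 1/2. *)
Lemma Cmod_Cexp_sub_1_sub (z : C) : Re z <= 0 -> Cmod (Cexp z - 1 - z) <= Cmod z ^ 2.
Proof.
  intros Hz.
  replace (Cexp z - 1 - z)%C with ((Cexp (1 * z) - 1 * z) - (Cexp (0 * z) - 0 * z))%C.
  2: { rewrite Cmult_1_l, Cmult_0_l, Cexp_RtoC, exp_0. ring. }
  apply (C_mean_value (fun s : R => Cexp (s * z) - s * z)%C (fun s : R => z * (Cexp (s * z) - 1))%C).
  - intros s _.
    replace (z * (Cexp (s * z) - 1))%C with (z * Cexp (s * z) - (1 * z + s * 0))%C by ring.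
    apply is_deriveC_minus; [apply is_deriveC_Cexp_ray|].
    apply is_deriveC_mult; [|apply is_deriveC_const].
    apply is_deriveC_RtoC. auto_derive; trivial.
  - intros s _. eapply is_deriveC_continuous.
    apply is_deriveC_mult; [apply is_deriveC_const|].
    apply is_deriveC_minus; [apply is_deriveC_Cexp_ray|apply is_deriveC_const].
  - intros s Hs. rewrite Cmod_mult.
    assert (H : Re (s * z)%C <= 0) by (destruct z; simpl in *; nra).
    assert (H1 := Cmod_Cexp_sub_1 _ H).
    rewrite Cmod_mult, Cmod_R, Rabs_pos_eq in H1 by lra.
    generalize (Cmod_ge_0 z). nra.
Qed.

Lemma ln_le_sub_1 (x : R) : 0 < x -> ln x <= x - 1.
Proof.
  intros Hx. generalize (exp_ineq1_le (ln x)). rewrite exp_ln by exact Hx. lra.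
Qed.

(** Near 0 the exponential estimate yields [2 * Cmod b * t]. For [t > 1/2] the trivial bound 2 is
    below [4 * t]. The constant is the sum of both. *)
Lemma Cmod_one_sub_Rcpow (b : C) (t : R) :
  0 < Re b -> 0 < t < 1 -> Cmod (1 - Rcpow (1 - t) b) <= (2 * Cmod b + 4) * t.
Proof.
  intros Hb Ht.
  assert (H0 := Cmod_ge_0 b).
  assert (Hl : ln (1 - t) <= 0) by (generalize (ln_le_sub_1 (1 - t)); lra).
  replace (1 - Rcpow (1 - t) b)%C with (- (Rcpow (1 - t) b - 1))%C by ring.
  rewrite Cmod_opp.
  destruct (Rle_dec t (1 / 2)) as [H|H].
  - eapply Rle_trans; [apply Cmod_Cexp_sub_1; destruct b; simpl in *; nra|].
    rewrite Cmod_mult, Cmod_R, Rabs_left1 by exact Hl.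
    (* ln (1/(1-t)) is at most 1/(1-t) - 1 = t/(1-t), and [1 - t] is at least 1/2. *)
    assert (- ln (1 - t) <= 2 * t).
    { rewrite <- ln_Rinv by lra.
      eapply Rle_trans; [apply ln_le_sub_1, Rinv_0_lt_compat; lra|].
      apply Rmult_le_reg_r with (1 - t); [lra|].
      rewrite Rmult_minus_distr_r, Rinv_l by lra. nra. }
    nra.
  - eapply Rle_trans; [apply Cmod_triangle|].
    rewrite Cmod_opp, Cmod_1, Cmod_Rcpow.
    assert (Rpower (1 - t) (Re b) <= Rpower 1 (Re b)) by (apply Rle_Rpower_l; lra).
    rewrite Rpower_1_base in *. nra.
Qed.

(** With [S n] in the second parameter of [B2], the integrands differ exactly by the factor 1 -
    (1-t)^b. Its bound [K t] raises the power t^(Re a - 1) to t^(Re a), whence the first parameter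
    [Re a + 1] of [B3]. *)
Lemma is_beta_compare (a b B1 B2 B3 : C) (n : nat) :
  0 < Re a -> 0 < Re b ->
  is_beta a (1 + INR n) B1 -> is_beta a (b + INR (S n)) B2 ->
  is_beta (Re a + 1) (1 + INR n) B3 ->
  Cmod (B1 - B2) <= (2 * Cmod b + 4) * Cmod B3.
Proof.
  intros Ha Hb H1 H2 H3.
  set (K := 2 * Cmod b + 4). assert (H0 := Cmod_ge_0 b).
  (* The norm inequality for integrals needs a real majorant, so the real part of the integral [B3]
     is used. *)
  apply Rle_trans with (K * Re B3).
  2: { apply Rmult_le_compat_l; [unfold K; lra|].
       eapply Rle_trans; [apply Rle_abs|apply re_le_Cmod]. }
  rewrite <- C_R_norm.
  apply (RInt_gen_norm (V := C_R_CompleteNormedModule) (Fa := at_right 0) (Fb := at_left 1)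
    (fun t => minus (beta_integrand a (1 + INR n) t : C_R_NormedModule) (beta_integrand a (b + INR (S n)) t))
    (fun t => scal K (Re (beta_integrand (Re a + 1) (1 + INR n) t)))).
  - apply (Filter_prod _ _ _ (fun t => 0 < t < 1 / 2) (fun t => 1 / 2 < t < 1)).
    + apply at_right_0_lt; lra.
    + apply at_left_1_gt; lra.
    + intros; simpl; lra.
  - apply (Filter_prod _ _ _ (fun t => 0 < t < 1) (fun t => 0 < t < 1)).
    + apply at_right_0_lt; lra.
    + apply at_left_1_gt; lra.
    + intros u v Hu Hv t Ht; simpl in Ht. rewrite C_R_norm.
      assert (Ht1 : 0 < t < 1) by lra. clear Ht.
      unfold beta_integrand.
      replace (Re a + 1 - 1)%C with (RtoC (Re a)) by ring.
      replace (1 + INR n - 1)%C with (RtoC (INR n)) by ring.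
      replace (b + INR (S n) - 1)%C with (INR n + b)%C
        by (rewrite S_INR, RtoC_plus; ring).
      rewrite !Rcpow_plus, !Rcpow_RtoC, <- RtoC_mult.
      change (Cmod (Rcpow t (a - 1) * Rpower (1 - t) (INR n)
                - Rcpow t (a - 1) * (Rpower (1 - t) (INR n) * Rcpow (1 - t) b))
              <= K * (Rpower t (Re a) * Rpower (1 - t) (INR n))).
      replace (Rcpow t (a - 1) * Rpower (1 - t) (INR n)
                - Rcpow t (a - 1) * (Rpower (1 - t) (INR n) * Rcpow (1 - t) b))%C
        with (Rcpow t (a - 1) * Rpower (1 - t) (INR n) * (1 - Rcpow (1 - t) b))%C by ring.
      assert (P1 : 0 < Rpower (1 - t) (INR n)) by apply exp_pos.
      assert (P2 : 0 < Rpower t (Re (a - 1)%C)) by apply exp_pos.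
      rewrite !Cmod_mult, Cmod_R, (Rabs_pos_eq (Rpower (1 - t) (INR n))), Cmod_Rcpow by lra.
      replace (Rpower t (Re a)) with (Rpower t (Re (a - 1)%C) * t).
      2: { replace (Re a) with (Re (a - 1)%C + 1) by (destruct a; simpl; ring).
           now rewrite Rpower_plus, Rpower_1 by lra. }
      assert (H := Cmod_one_sub_Rcpow b t Hb Ht1). fold K in H.
      apply Rle_trans with (Rpower t (Re (a - 1)%C) * Rpower (1 - t) (INR n) * (K * t)).
      * apply Rmult_le_compat_l; [nra|exact H].
      * right; ring.
  - apply (is_RInt_gen_minus (V := C_R_NormedModule)); assumption.
  - apply (is_RInt_gen_scal (V := R_NormedModule)).
    exact (is_RInt_gen_Re (at_right 0) (at_left 1) _ _ H3).
Qed.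

(** * Convergence of the Gauss product *)

(** The differences 1/(n+1) - 1/(n+2) telescope, so the distance from the [n]-th term to any later
    one is at most M/(n+1). *)
Lemma eventually_Cauchy_limit (P : nat -> C) (M : R) :
  (forall n, Cmod (P (S n) - P n) <= M * (/ INR (S n) - / INR (S (S n)))) ->
  exists l : C, filterlim P eventually (locally l).
Proof.
  intros H.
  assert (H0 : forall n d, Cmod (P (n + d)%nat - P n) <= M * (/ INR (S n) - / INR (S (n + d)))).
  { intros n d. induction d as [|d IH].
    - rewrite Nat.add_0_r. replace (P n - P n)%C with (RtoC 0) by ring. rewrite Cmod_0. right; ring.
    - rewrite Nat.add_succ_r.
      replace (P (S (n + d)) - P n)%C with ((P (S (n + d)) - P (n + d)%nat) + (P (n + d)%nat - P n))%C by ring.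
      eapply Rle_trans; [apply Cmod_triangle|]. generalize (H (n + d)%nat). lra. }
  assert (HM : 0 <= M).
  { generalize (Rle_trans _ _ _ (Cmod_ge_0 _) (H 0%nat)). simpl. lra. }
  apply (filterlim_locally_cauchy (U := C_R_CompleteNormedModule) P).
  intros eps. destruct (nfloor_ex (M / (eps / 2))) as [N HN].
  { apply Rdiv_le_0_compat; [exact HM|]. generalize (cond_pos eps); lra. }
  assert (He := cond_pos eps).
  assert (HN' : M * / INR (S N) < eps / 2).
  { assert (0 < INR (S N)) by (rewrite S_INR; generalize (pos_INR N); lra).
    apply Rmult_lt_reg_r with (INR (S N)); [assumption|].
    rewrite Rmult_assoc, Rinv_l by lra.
    destruct HN as [_ HN]. rewrite <- S_INR in HN. apply Rlt_div_l in HN; lra. }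
  assert (HPN : forall u, (N <= u)%nat -> Cmod (P u - P N) < eps / 2).
  { intros u Hu. replace u with (N + (u - N))%nat by lia.
    eapply Rle_lt_trans; [apply H0|].
    assert (0 < / INR (S (N + (u - N)))) by (apply Rinv_0_lt_compat, lt_0_INR; lia).
    nra. }
  exists (fun n => (N <= n)%nat). split; [now exists N|].
  intros u v Hu Hv. apply C_NormedModule_mixin_compat1.
  change (Cmod (P v - P u) < eps).
  replace (P v - P u)%C with ((P v - P N) + - (P u - P N))%C by ring.
  eapply Rle_lt_trans; [apply Cmod_triangle|]. rewrite Cmod_opp.
  generalize (HPN u Hu) (HPN v Hv). lra.
Qed.

(** From 1 + s <= exp s and telescoping, the partial products stay bounded by [Cmod (P 0) * exp K];
    the increments [P n * u n] then inherit the telescoping bound on [u]. *)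
Lemma infinite_product_converges (P u : nat -> C) (K : R) :
  (forall n, P (S n) = P n * (1 + u n))%C ->
  (forall n, Cmod (u n) <= K * (/ INR (S n) - / INR (S (S n)))) ->
  exists l : C, filterlim P eventually (locally l).
Proof.
  intros HP Hu.
  assert (HK : 0 <= K).
  { generalize (Rle_trans _ _ _ (Cmod_ge_0 _) (Hu 0%nat)). simpl. lra. }
  assert (Hb : forall n, Cmod (P n) <= Cmod (P 0%nat) * exp (K * (1 - / INR (S n)))).
  { intros n. induction n as [|n IH].
    - simpl. rewrite Rinv_1, Rminus_diag, Rmult_0_r, exp_0. lra.
    - rewrite HP, Cmod_mult.
      apply Rle_trans with (Cmod (P 0%nat) * exp (K * (1 - / INR (S n)))
        * exp (K * (/ INR (S n) - / INR (S (S n))))).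
      + apply Rmult_le_compat; try apply Cmod_ge_0; [exact IH|].
        eapply Rle_trans; [apply Cmod_triangle|]. rewrite Cmod_1.
        eapply Rle_trans; [apply Rplus_le_compat_l, Hu|]. apply exp_ineq1_le.
      + rewrite Rmult_assoc, <- exp_plus. right. f_equal. f_equal. ring. }
  apply (eventually_Cauchy_limit P (Cmod (P 0%nat) * exp K * K)).
  intros n. rewrite HP.
  replace (P n * (1 + u n) - P n)%C with (P n * u n)%C by ring.
  rewrite Cmod_mult, (Rmult_assoc _ K).
  apply Rmult_le_compat; try apply Cmod_ge_0; [|apply Hu].
  eapply Rle_trans; [apply Hb|]. apply Rmult_le_compat_l; [apply Cmod_ge_0|].
  apply exp_le_compat.
  assert (0 < / INR (S n)) by (apply Rinv_0_lt_compat, lt_0_INR; lia). nra.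
Qed.

(** The left-hand product is the ratio of [gauss a] at [N] to its value at [N + 1]. This inverse
    ratio is preferred because its exponent has nonpositive real part, as the exponential estimates
    require, and its other factor is affine in [a]. *)
Lemma gauss_ratio_bound (a : C) (N : R) :
  0 < Re a -> 1 <= N ->
  Cmod (Cexp (- (a * ln ((N + 1) / N))) * (1 + a * / (N + 1)) - 1) <=
    (2 * Cmod a ^ 2 * (1 + Cmod a) + Cmod a + Cmod a ^ 2) * (/ N - / (N + 1)).
Proof.
  intros Ha HN.
  (* [L] lies between [h] and 1/N, so [L - h] is at most the telescoping difference [d = h/N], while
     [L * L <= 2 * d] and [L * h <= d]. *)
  set (L := ln ((N + 1) / N)). set (h := / (N + 1)). set (d := / N - h).
  assert (Hh : 0 < h) by (apply Rinv_0_lt_compat; lra).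
  assert (HL1 : L <= / N).
  { unfold L. eapply Rle_trans; [apply ln_le_sub_1, Rdiv_lt_0_compat; lra|]. right; field; lra. }
  assert (HL2 : h <= L).
  { assert (E : L = - ln (N / (N + 1))).
    { unfold L. rewrite <- ln_Rinv by (apply Rdiv_lt_0_compat; lra). f_equal. field; lra. }
    rewrite E. assert (H : 0 < N / (N + 1)) by (apply Rdiv_lt_0_compat; lra).
    apply ln_le_sub_1 in H. replace h with (- (N / (N + 1) - 1)); [lra|].
    unfold h. field; lra. }
  assert (Hd : d = / N * h) by (unfold d, h; field; lra).
  assert (HN1 : 0 < / N) by (apply Rinv_0_lt_compat; lra).
  assert (HNh : / N <= 2 * h).
  { apply Rmult_le_reg_r with (N * (N + 1)); [nra|]. unfold h. field_simplify; lra. }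
  assert (Hd1 : 0 < d) by nra.
  assert (HLh : L - h <= d) by (unfold d; lra).
  assert (HLL : L * L <= 2 * d) by (rewrite Hd; nra).
  assert (HLh2 : L * h <= d) by (rewrite Hd; nra).
  assert (Hh1 : h <= 1) by (unfold h; rewrite <- Rinv_1; apply Rinv_le_contravar; lra).
  clearbody L. clear HL1 HNh Hd HN1.
  set (z := (- (a * L))%C).
  assert (Hz : Re z <= 0) by (unfold z; destruct a; simpl in *; nra).
  assert (Mz : Cmod z = Cmod a * L).
  { unfold z. rewrite Cmod_opp, Cmod_mult, Cmod_R, Rabs_pos_eq by lra. reflexivity. }
  assert (H0 := Cmod_ge_0 a).
  (* Expanding Cexp z as (Cexp z - 1 - z) + (1 + z) with z = -aL leaves the first-order terms only
     as a(h - L); every summand is now of order [d]. *)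
  replace (Cexp z * (1 + a * / (N + 1)) - 1)%C
    with ((Cexp z - 1 - z) * (1 + a * h) + (a * RtoC (h - L) + - (a * a * RtoC (L * h))))%C.
  2: { unfold z, h. rewrite RtoC_minus, RtoC_mult, !RtoC_inv, RtoC_plus by lra.
       field. cbv beta. rewrite <- RtoC_plus. apply RtoC_nonzero; lra. }
  eapply Rle_trans; [apply Cmod_triangle|].
  eapply Rle_trans; [apply Rplus_le_compat_l, Cmod_triangle|].
  rewrite Cmod_opp, !Cmod_mult, !Cmod_R, (Rabs_left1 (h - L)), (Rabs_pos_eq (L * h)) by nra.
  assert (H1 := Cmod_Cexp_sub_1_sub z Hz). rewrite Mz in H1.
  assert (H2 : Cmod (1 + a * h) <= 1 + Cmod a).
  { eapply Rle_trans; [apply Cmod_triangle|].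
    rewrite Cmod_1, Cmod_mult, Cmod_R, Rabs_pos_eq by lra. nra. }
  assert (H3 : Cmod (Cexp z - 1 - z) * Cmod (1 + a * h) <= (2 * Cmod a ^ 2 * d) * (1 + Cmod a)).
  { apply Rmult_le_compat; try apply Cmod_ge_0; [|exact H2].
    eapply Rle_trans; [exact H1|]. replace ((Cmod a * L) ^ 2) with (Cmod a ^ 2 * (L * L)) by ring.
    replace (2 * Cmod a ^ 2 * d) with (Cmod a ^ 2 * (2 * d)) by ring.
    apply Rmult_le_compat_l; [apply pow2_ge_0|exact HLL]. }
  assert (H4 : Cmod a * - (h - L) <= Cmod a * d) by (apply Rmult_le_compat_l; lra).
  assert (H5 : Cmod a * Cmod a * (L * h) <= Cmod a * Cmod a * d) by (apply Rmult_le_compat_l; nra).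
  simpl pow in *. rewrite Rmult_1_r in *. lra.
Qed.

(** At [n = 0] the power has base 0 and a junk value, so limits are studied from index 1 on. *)
Definition gauss (a : C) (n : nat) : C :=
  (INR (fact n) * Rcpow (INR n) a / rising a (S n))%C.

Lemma INR_nonzero (n : nat) : RtoC (INR (S n)) <> RtoC 0.
Proof. apply RtoC_nonzero, not_0_INR. lia. Qed.

Lemma INR_fact_nonzero (n : nat) : RtoC (INR (fact n)) <> RtoC 0.
Proof. apply RtoC_nonzero, INR_fact_neq_0. Qed.

Lemma Cinv_nonzero (z : C) : z <> RtoC 0 -> (/ z)%C <> RtoC 0.
Proof.
  intros Hz E. apply (RtoC_nonzero 1); [lra|]. rewrite <- (Cinv_r z Hz), E. ring.
Qed.

Lemma gauss_nonzero (a : C) (n : nat) : 0 < Re a -> gauss a n <> RtoC 0.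
Proof.
  intros Ha. unfold gauss, Cdiv. apply Cmult_neq_0; [apply Cmult_neq_0|].
  - apply INR_fact_nonzero.
  - apply Rcpow_nonzero.
  - now apply Cinv_nonzero, rising_nonzero.
Qed.

(* Both the sequence and its inverse are products with absolutely summable
   deviations from [1], so both converge and the limit cannot vanish. *)
Lemma gauss_converges (a : C) :
  0 < Re a -> exists l : C, l <> RtoC 0 /\ filterlim (gauss a) eventually (locally l).
Proof.
  intros Ha.
  set (K := 2 * Cmod a ^ 2 * (1 + Cmod a) + Cmod a + Cmod a ^ 2).
  set (v := fun n => (Cexp (- (a * ln ((INR (S n) + 1) / INR (S n)))) * (1 + a * / (INR (S n) + 1)) - 1)%C).
  set (r := fun n => (/ (1 + v n))%C).
  assert (HN : forall n, 1 <= INR (S n)) by (intros n; rewrite S_INR; generalize (pos_INR n); lra).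
  assert (Hv : forall n, Cmod (v n) <= K * (/ INR (S n) - / INR (S (S n)))).
  { intros n. rewrite (S_INR (S n)). exact (gauss_ratio_bound a (INR (S n)) Ha (HN n)). }
  assert (Hz : forall n, (1 + a * / (INR (S n) + 1))%C = (1 + a * RtoC (/ (INR (S n) + 1)))%C).
  { intros n. rewrite RtoC_inv, RtoC_plus by (generalize (HN n); lra). reflexivity. }
  (* Since [Re a > 0], this factor has real part at least 1; it cannot vanish and its inverse has
     modulus at most 1. *)
  assert (Hre : forall n, 1 <= Cmod (1 + a * / (INR (S n) + 1))).
  { intros n. rewrite Hz. eapply Rle_trans; [|apply re_le_Cmod].
    eapply Rle_trans; [|apply Rle_abs].
    assert (0 < / (INR (S n) + 1)) by (apply Rinv_0_lt_compat; generalize (HN n); lra).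
    destruct a; simpl in *; nra. }
  assert (Hv1 : forall n, (1 + v n)%C = (Rcpow ((INR (S n) + 1) / INR (S n)) (- a) * (1 + a * / (INR (S n) + 1)))%C).
  { intros n. unfold v, Rcpow.
    replace (- a * ln ((INR (S n) + 1) / INR (S n)))%C
      with (- (a * ln ((INR (S n) + 1) / INR (S n))))%C by ring. ring. }
  assert (Hnz : forall n, (1 + v n)%C <> RtoC 0).
  { intros n. rewrite Hv1. apply Cmult_neq_0; [apply Rcpow_nonzero|].
    apply Cmod_gt_0. generalize (Hre n); lra. }
  assert (Hstep : forall n, (/ gauss a (S (S n)))%C = (/ gauss a (S n) * (1 + v n))%C).
  { intros n. rewrite Hv1, Rcpow_opp.
    assert (H1 := gauss_nonzero a (S n) Ha). assert (H2 := gauss_nonzero a (S (S n)) Ha).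
    assert (P := HN n).
    rewrite Rcpow_div_base, <- (S_INR (S n)) by lra.
    unfold gauss in *.
    change (rising a (S (S (S n)))) with (rising a (S (S n)) * (a + INR (S (S n))))%C.
    rewrite (fact_simpl (S n)), mult_INR, RtoC_mult.
    rewrite <- RtoC_plus, <- (S_INR (S n)).
    assert (R1 := rising_nonzero a (S (S n)) Ha).
    assert (R2 := C_nonzero_of_Re _ (Re_plus_INR a (S (S n)) Ha)).
    assert (R3 := INR_nonzero (S n)). assert (R4 := INR_fact_nonzero (S n)).
    assert (R5 := Rcpow_nonzero (INR (S n)) a). assert (R6 := Rcpow_nonzero (INR (S (S n))) a).
    set (A1 := RtoC (INR (S (S n)))) in *. set (A2 := rising a (S (S n))) in *.
    set (A3 := RtoC (INR (fact (S n)))) in *.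
    set (A4 := Rcpow (INR (S n)) a) in *. set (A5 := Rcpow (INR (S (S n))) a) in *.
    field. repeat split; assumption. }
  (* A uniform bound on [r] lets [r - 1 = - r v] inherit the summable bound on [v]. It follows from
     ln (1 + 1/N) <= 1. *)
  assert (Hr : forall n, Cmod (r n) <= exp (Re a)).
  { intros n. unfold r. rewrite Cmod_inv by apply Hnz. rewrite Hv1, Cmod_mult, Cmod_Rcpow.
    replace (Re (- a)%C) with (- Re a) by (destruct a; reflexivity).
    rewrite Rpower_Ropp, Rinv_mult, Rinv_inv.
    assert (P := HN n).
    assert (0 < / INR (S n)) by (apply Rinv_0_lt_compat; lra).
    assert (/ INR (S n) <= 1) by (rewrite <- Rinv_1; apply Rinv_le_contravar; lra).
    assert (H1 : Rpower ((INR (S n) + 1) / INR (S n)) (Re a) <= exp (Re a)).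
    { unfold Rpower. apply exp_le_compat.
      assert (H2 : ln ((INR (S n) + 1) / INR (S n)) <= 1).
      { eapply Rle_trans; [apply ln_le_sub_1, Rdiv_lt_0_compat; lra|].
        replace ((INR (S n) + 1) / INR (S n) - 1) with (/ INR (S n)) by (field; lra). assumption. }
      nra. }
    assert (H3 : / Cmod (1 + a * / (INR (S n) + 1)) <= / 1)
      by (apply Rinv_le_contravar; [lra|apply Hre]).
    rewrite Rinv_1 in H3.
    assert (H4 : 0 < / Cmod (1 + a * / (INR (S n) + 1)))
      by (apply Rinv_0_lt_compat; generalize (Hre n); lra).
    assert (H5 := exp_pos (Re a)).
    assert (H6 : 0 < Rpower ((INR (S n) + 1) / INR (S n)) (Re a)) by apply exp_pos.
    nra. }
  destruct (infinite_product_converges (fun n => / gauss a (S n))%C v K Hstep Hv) as [m Hm].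
  destruct (infinite_product_converges (fun n => gauss a (S n)) (fun n => r n - 1)%C (exp (Re a) * K))
    as [l Hl].
  { intros n. replace (1 + (r n - 1))%C with (r n) by ring. unfold r.
    assert (E := Hstep n). assert (H1 := gauss_nonzero a (S n) Ha).
    assert (H2 := gauss_nonzero a (S (S n)) Ha). assert (H3 := Hnz n).
    replace (gauss a (S (S n))) with (/ / gauss a (S (S n)))%C by (field; exact H2).
    rewrite E. field. split; assumption. }
  { intros n. replace (r n - 1)%C with (- (r n * v n))%C.
    - rewrite Cmod_opp, Cmod_mult, Rmult_assoc.
      apply Rmult_le_compat; try apply Cmod_ge_0; [apply Hr|apply Hv].
    - unfold r. field. apply Hnz. }
  exists l. split.
  - assert (E : (l * m)%C = RtoC 1).
    { apply (filterlim_C_unique eventually (fun n => gauss a (S n) * / gauss a (S n))%C).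
      - now apply filterlim_C_mult; try typeclasses eauto.
      - apply filterlim_ext with (fun _ : nat => RtoC 1); [|apply filterlim_const].
        intros n. field. now apply gauss_nonzero. }
    intros El. rewrite El, Cmult_0_l in E. now apply (RtoC_nonzero 1); [lra|].
  - intros Q HQ. destruct (Hl Q HQ) as [N HN']. exists (S N).
    intros [|n] Hn; [lia|]. apply HN'. lia.
Qed.

Lemma filterlim_C_squeeze_0 {T : Type} (F : (T -> Prop) -> Prop) {FF : Filter F} (f g : T -> C) :
  F (fun t => Cmod (f t) <= Cmod (g t)) ->
  filterlim g F (locally (RtoC 0)) -> filterlim f F (locally (RtoC 0)).
Proof.
  rewrite !(filterlim_Cmod F). intros Hle Hg eps He.
  generalize (filter_and (F := F) _ _ Hle (Hg eps He)). apply filter_imp.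
  intros t [H1 H2].
  replace (f t - 0)%C with (f t) by ring. replace (g t - 0)%C with (g t) in H2 by ring. lra.
Qed.

Lemma filterlim_inv_INR : filterlim (fun n => RtoC (/ INR n)) eventually (locally (RtoC 0)).
Proof.
  apply filterlim_Cmod; [typeclasses eauto|]. intros eps He.
  destruct (archimed_cor1 eps He) as [N [HN HN0]]. exists N. intros n Hn.
  replace (RtoC (/ INR n) - 0)%C with (RtoC (/ INR n)) by ring.
  assert (0 < INR N) by (apply lt_0_INR; lia).
  assert (INR N <= INR n) by (apply le_INR; lia).
  rewrite Cmod_R, Rabs_pos_eq.
  - eapply Rle_lt_trans; [apply Rinv_le_contravar; [|eassumption]|]; assumption.
  - apply Rlt_le, Rinv_0_lt_compat. lra.
Qed.

(* [gauss a n = n^a B(a, n+1)] and [gauss (a+b) n B(a, b) = gauss b n * n^a B(a, b+n+1)],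
   while [n^a (B(a, n+1) - B(a, b+n+1))] is [O(1/n)]. *)
Lemma gauss_limits_beta (a b B la lb lab : C) :
  0 < Re a -> 0 < Re b -> is_beta a b B ->
  filterlim (gauss a) eventually (locally la) ->
  filterlim (gauss b) eventually (locally lb) ->
  filterlim (gauss (a + b)) eventually (locally lab) ->
  (la * lb)%C = (lab * B)%C.
Proof.
  intros Ha Hb HB Hla Hlb Hlab.
  enough (E : (la * lb + - (1) * (lab * B))%C = RtoC 0).
  { replace (la * lb)%C with (la * lb + - (1) * (lab * B) + lab * B)%C by ring. rewrite E. ring. }
  set (d := fun n => (gauss a n * gauss b n + - (1) * (gauss (a + b) n * B))%C).
  apply (filterlim_C_unique eventually d).
  { assert (H1 := filterlim_C_mult eventually _ _ _ _ Hla Hlb).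
    assert (H2 := filterlim_C_mult eventually _ _ _ _ Hlab (filterlim_const B)).
    assert (H3 := filterlim_C_mult eventually _ _ _ _ (filterlim_const (- (1))%C) H2).
    exact (filterlim_C_plus eventually _ _ _ _ H1 H3). }
  assert (Ha1 : 0 < Re (Re a + 1)%C) by (simpl; lra).
  destruct (gauss_converges _ Ha1) as (l1 & _ & Hl1).
  set (K := 2 * Cmod b + 4).
  (* The error n^(Re a) B(Re a + 1, n + 1) equals [gauss (Re a + 1) n / n], a convergent sequence
     divided by [n]. *)
  apply (filterlim_C_squeeze_0 eventually d
           (fun n => K * gauss b n * (gauss (Re a + 1) n * RtoC (/ INR n)))%C).
  2: { replace (RtoC 0) with (K * lb * (l1 * 0))%C by ring.
     assert (H1 := filterlim_C_mult eventually _ _ _ _ (filterlim_const (RtoC K)) Hlb).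
     assert (H2 := filterlim_C_mult eventually _ _ _ _ Hl1 filterlim_inv_INR).
     exact (filterlim_C_mult eventually _ _ _ _ H1 H2). }
  exists 1%nat. intros n Hn.
  assert (Hn0 : 0 < INR n) by (apply lt_0_INR; lia).
  set (B1 := (INR (fact n) / rising a (S n))%C).
  set (B2 := (rising b (S n) / rising (a + b) (S n) * B)%C).
  set (B3 := (INR (fact n) / rising (Re a + 1) (S n))%C).
  assert (H := is_beta_compare a b B1 B2 B3 n Ha Hb (is_beta_nat a n Ha)
                 (is_beta_shift_n a b B (S n) Ha Hb HB) (is_beta_nat _ n Ha1)).
  fold K in H.
  assert (Hab : 0 < Re (a + b)%C) by (rewrite Re_plus; lra).
  assert (N1 := rising_nonzero a (S n) Ha). assert (N2 := rising_nonzero b (S n) Hb).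
  assert (N3 := rising_nonzero _ (S n) Hab). assert (N4 := rising_nonzero _ (S n) Ha1).
  replace (d n) with (gauss b n * (Rcpow (INR n) a * (B1 - B2)))%C.
  2: { unfold d, gauss, B1, B2. rewrite Rcpow_plus. field. repeat split; assumption. }
  replace (gauss (Re a + 1) n * RtoC (/ INR n))%C with (Rcpow (INR n) (Re a) * B3)%C.
  2: { unfold gauss, B3. rewrite Rcpow_plus, Rcpow_1, RtoC_inv by lra.
       field. split; [apply RtoC_nonzero; lra|exact N4]. }
  assert (HK : 0 <= K) by (unfold K; generalize (Cmod_ge_0 b); lra).
  rewrite !Cmod_mult, !Cmod_Rcpow, Cmod_R, Rabs_pos_eq by exact HK. simpl (Re (RtoC _)).
  assert (P1 := Cmod_ge_0 (gauss b n)).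
  assert (P2 : 0 < Rpower (INR n) (Re a)) by apply exp_pos.
  replace (K * Cmod (gauss b n) * (Rpower (INR n) (Re a) * Cmod B3))
    with (Cmod (gauss b n) * (Rpower (INR n) (Re a) * (K * Cmod B3))) by ring.
  apply Rmult_le_compat_l; [exact P1|]. apply Rmult_le_compat_l; [lra|exact H].
Qed.

(** * From the p-k Gamma function to the Gauss product *)

Lemma Re_div_RtoC (x : C) (k : R) : 0 < k -> Re (x / k)%C = Re x / k.
Proof.
  intros Hk. unfold Cdiv. rewrite <- RtoC_inv by lra.
  destruct x; simpl. unfold Rdiv. ring.
Qed.

Lemma pk_pochhammer_rising (p k : R) (x : C) (n : nat) :
  0 < k -> pk_pochhammer p k x n = (RtoC (p ^ n) * rising (x / k) n)%C.
Proof.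
  intros Hk. assert (Hk0 : RtoC k <> RtoC 0) by (apply RtoC_nonzero; lra).
  induction n as [|n IH]; simpl.
  - ring.
  - rewrite IH, RtoC_mult. field. exact Hk0.
Qed.

(** [lim] is specified only on proper Cauchy filters. Convergence of [u] makes its image filter
    Cauchy, after which uniqueness of limits applies. *)
Lemma lim_C_eq (u : nat -> C) (l : C) :
  filterlim u eventually (locally l) ->
  lim (T := C_R_CompleteNormedModule) (filtermap u eventually) = l.
Proof.
  intros H.
  apply (filterlim_C_unique eventually u); [|exact H].
  apply filterlim_locally. intros eps.
  apply (complete_cauchy (T := C_R_CompleteNormedModule) (filtermap u eventually)).
  - typeclasses eauto.
  - intros e. exists l. apply H. apply (locally_ball (T := C_R_NormedModule)).
Qed.

Lemma pk_gamma_eq (p k : R) (x l : C) :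
  0 < p -> 0 < k -> 0 < Re x ->
  filterlim (gauss (x / k)) eventually (locally l) ->
  pk_gamma p k x = (1 / k * (Rcpow p (x / k) * l))%C.
Proof.
  intros Hp Hk Hx Hl. unfold pk_gamma. f_equal. apply lim_C_eq.
  assert (Hxk : 0 < Re (x / k)%C) by (rewrite Re_div_RtoC by exact Hk; now apply Rdiv_lt_0_compat).
  assert (H := filterlim_C_mult eventually _ _ _ _ (filterlim_const (Rcpow p (x / k))) Hl).
  (* Splitting (np)^(x/k) into powers of [n] and [p] requires [n] positive. *)
  revert H. apply filterlim_ext_loc. exists 1%nat. intros n Hn.
  unfold pk_gamma_seq, gauss. rewrite pk_pochhammer_rising by exact Hk.
  rewrite Rcpow_mult_base by (try apply lt_0_INR; lia || lra).
  assert (H1 := rising_nonzero (x / k) (S n) Hxk).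
  assert (H2 : RtoC (p ^ S n) <> RtoC 0) by (apply RtoC_nonzero, pow_nonzero; lra).
  set (A1 := Rcpow p (x / k)). set (A2 := Rcpow (INR n) (x / k)).
  set (A3 := rising (x / k) (S n)) in *. set (A4 := RtoC (p ^ S n)) in *.
  field. split; assumption.
Qed.

(** The powers of [p] cancel because exponents add, and the denominator absorbs one of the two
    factors 1/k, so the result is independent of [p]. *)
Lemma pk_beta_eq (p k : R) (x y B : C) :
  0 < p -> 0 < k -> 0 < Re x -> 0 < Re y ->
  is_beta (x / k) (y / k) B -> pk_beta p k x y = (1 / k * B)%C.
Proof.
  intros Hp Hk Hx Hy HB.
  assert (Hk0 : RtoC k <> RtoC 0) by (apply RtoC_nonzero; lra).
  assert (Hxk : 0 < Re (x / k)%C) by (rewrite Re_div_RtoC by exact Hk; now apply Rdiv_lt_0_compat).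
  assert (Hyk : 0 < Re (y / k)%C) by (rewrite Re_div_RtoC by exact Hk; now apply Rdiv_lt_0_compat).
  assert (Hxy : 0 < Re (x + y)%C) by (rewrite Re_plus; lra).
  assert (E : ((x + y) / k)%C = (x / k + y / k)%C) by (field; exact Hk0).
  destruct (gauss_converges _ Hxk) as (la & _ & Hla).
  destruct (gauss_converges _ Hyk) as (lb & _ & Hlb).
  destruct (gauss_converges (x / k + y / k)%C) as (lab & Hlab0 & Hlab); [rewrite Re_plus; lra|].
  assert (H := gauss_limits_beta _ _ _ _ _ _ Hxk Hyk HB Hla Hlb Hlab).
  unfold pk_beta.
  rewrite (pk_gamma_eq p k x la), (pk_gamma_eq p k y lb) by assumption.
  rewrite (pk_gamma_eq p k (x + y)%C lab) by (try rewrite E; assumption).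
  rewrite E, Rcpow_plus.
  assert (P1 := Rcpow_nonzero p (x / k)). assert (P2 := Rcpow_nonzero p (y / k)).
  set (A1 := Rcpow p (x / k)) in *. set (A2 := Rcpow p (y / k)) in *.
  replace (1 / k * (A1 * la) * (1 / k * (A2 * lb)))%C
    with (1 / k * A1 * (1 / k) * A2 * (la * lb))%C by ring.
  rewrite H. field. repeat split; assumption.
Qed.

(** * Substitutions in the Beta integral *)

Lemma Rcpow_one_base (z : C) : Rcpow 1 z = RtoC 1.
Proof. unfold Rcpow. now rewrite ln_1, Cmult_0_r, Cexp_RtoC, exp_0. Qed.

(** The homogeneous form in [u], [v] serves the substitutions u/(u+1) and 1/(1+u) alike; the factor
    (u+v)^2 is there to cancel their Jacobian. *)
Lemma beta_integrand_ratio (a b : C) (u v : R) :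
  0 < u -> 0 < v ->
  beta_integrand a b (u / (u + v)) =
    (Rcpow u (a - 1) * Rcpow v (b - 1) * RtoC ((u + v) ^ 2) / Rcpow (u + v) (a + b))%C.
Proof.
  intros Hu Hv. unfold beta_integrand.
  replace (1 - u / (u + v)) with (v / (u + v)) by (field; lra).
  rewrite !Rcpow_div_base by lra.
  replace (a + b)%C with ((a - 1) + (b - 1) + 1 + 1)%C by ring.
  rewrite (Rcpow_plus (u + v) (_ + 1)%C), (Rcpow_plus (u + v) (a - 1 + (b - 1))%C),
    (Rcpow_plus (u + v) (a - 1)), Rcpow_1 by lra.
  assert (H1 := Rcpow_nonzero (u + v) (a - 1)). assert (H2 := Rcpow_nonzero (u + v) (b - 1)).
  assert (H3 : RtoC (u + v) <> RtoC 0) by (apply RtoC_nonzero; lra).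
  replace (RtoC ((u + v) ^ 2)) with (RtoC (u + v) * RtoC (u + v))%C
    by (rewrite <- RtoC_mult; f_equal; ring).
  field. repeat split; assumption.
Qed.

Lemma filterlim_ratio_at_right_0 : filterlim (fun u => u / (u + 1)) (at_right 0) (at_right 0).
Proof.
  intros P [eps HP]. generalize (at_right_0_lt eps (cond_pos eps)). unfold filtermap.
  apply filter_imp. intros u Hu.
  assert (H : 0 < u / (u + 1)) by (apply Rdiv_lt_0_compat; lra).
  apply HP; [|exact H].
  change (Rabs (u / (u + 1) - 0) < eps). rewrite Rminus_0_r, Rabs_pos_eq by lra.
  apply Rle_lt_trans with u; [|lra]. apply Rle_div_l; nra.
Qed.

Lemma filterlim_inv_ratio_at_right_0 : filterlim (fun u => 1 / (1 + u)) (at_right 0) (at_left 1).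
Proof.
  apply filterlim_ext_loc with (fun u => 1 - u / (u + 1)).
  - generalize (at_right_0_lt 1 Rlt_0_1). apply filter_imp. intros u Hu. field; lra.
  - apply (filterlim_comp _ _ _ (fun u => u / (u + 1)) (fun t => 1 - t) _ (at_right 0)).
    + apply filterlim_ratio_at_right_0.
    + apply filterlim_one_minus_at_right.
Qed.

(* Substitute [t = u / (u + 1)] on [(0, 1/2)] and [t = 1 / (1 + u)] on [(1/2, 1)]. *)
Lemma beta_unit_interval (a b : C) (F : R -> C) (l0 l1 : C) :
  (forall t, 0 < t < 1 -> is_deriveC F t (beta_integrand a b t)) ->
  filterlim F (at_right 0) (locally l0) -> filterlim F (at_left 1) (locally l1) ->
  is_RInt_gen (V := C_R_NormedModule)
    (fun t => (Rcpow t (a - 1) + Rcpow t (b - 1)) / Rcpow (t + 1) (a + b))%C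
    (at_right 0) (at_left 1) (l1 - l0)%C.
Proof.
  intros HF H0 H1.
  set (G := fun u : R => (F (u / (u + 1))%R - F (1 / (1 + u))%R)%C).
  (* [G] tends to [l0 - l1] at 0, and at 1 its two terms meet at [F (1/2)] and cancel. The minus
     sign in [G] accounts for the decreasing substitution 1/(1+u). *)
  replace (l1 - l0)%C with ((F (1 / 2)%R - F (1 / 2)%R) - (l0 - l1))%C by ring.
  apply (is_RInt_gen_01_primitive G).
  - intros u Hu.
    assert (D1 : is_derive (fun u => u / (u + 1)) u (/ (u + 1) ^ 2)) by (auto_derive; [lra|field; lra]).
    assert (D2 : is_derive (fun u => 1 / (1 + u)) u (- / (u + 1) ^ 2)) by (auto_derive; [lra|field; lra]).
    assert (R1 : 0 < u / (u + 1) < 1).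
    { split; [apply Rdiv_lt_0_compat; lra|]. apply Rlt_div_l; lra. }
    assert (R2 : 0 < 1 / (1 + u) < 1).
    { split; [apply Rdiv_lt_0_compat; lra|]. apply Rlt_div_l; lra. }
    assert (D := is_deriveC_minus _ _ _ _ _ (is_deriveC_comp F _ u _ _ (HF _ R1) D1)
                   (is_deriveC_comp F _ u _ _ (HF _ R2) D2)).
    rewrite !beta_integrand_ratio, !Rcpow_one_base, (Rplus_comm 1 u), RtoC_opp in D by lra.
    match type of D with is_derive _ _ ?l => match goal with |- is_derive _ _ ?m =>
      replace m with l; [exact D|] end end.
    assert (N1 := Rcpow_nonzero (u + 1) (a + b)).
    assert (N2 : (RtoC (/ (u + 1) ^ 2) * RtoC ((u + 1) ^ 2))%C = RtoC 1).
    { rewrite <- RtoC_mult. f_equal. field; lra. }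
    set (A1 := RtoC (/ (u + 1) ^ 2)) in *. set (A2 := RtoC ((u + 1) ^ 2)) in *.
    transitivity ((A1 * A2) * (Rcpow u (a - 1) + Rcpow u (b - 1)) / Rcpow (u + 1) (a + b))%C.
    + field. exact N1.
    + rewrite N2. field. exact N1.
  - intros u Hu.
    apply (continuous_ext (T := R_UniformSpace) (U := C_R_NormedModule)
      (fun t : R => (Rcpow t (a - 1) + Rcpow t (b - 1)) * Rcpow (t + 1) (- (a + b)))%C).
    { intros t. rewrite Rcpow_opp. reflexivity. }
    eapply is_deriveC_continuous. apply is_deriveC_mult.
    + apply is_deriveC_plus; apply is_deriveC_Rcpow; lra.
    + apply (is_deriveC_comp (fun t => Rcpow t (- (a + b))) (fun t => t + 1)).
      * apply is_deriveC_Rcpow; lra.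
      * auto_derive; [trivial|reflexivity].
  - apply (filterlim_comp_2 (G := locally (l0 : C_R_NormedModule)) (H := locally (opp (l1 : C_R_NormedModule)))
             (fun u => F (u / (u + 1))) (fun u => opp (F (1 / (1 + u)) : C_R_NormedModule)) plus).
    + exact (filterlim_comp _ _ _ _ F _ _ _ filterlim_ratio_at_right_0 H0).
    + apply (filterlim_comp _ _ _ (fun u => F (1 / (1 + u))) opp _ (locally (l1 : C_R_NormedModule))).
      * exact (filterlim_comp _ _ _ _ F _ _ _ filterlim_inv_ratio_at_right_0 H1).
      * apply (filterlim_opp (V := C_R_NormedModule)).
    + apply (filterlim_plus (V := C_R_NormedModule)).
  - assert (D1 : is_derive (fun u => u / (u + 1)) 1 (1 / 4)) by (auto_derive; [lra|field]).
    assert (D2 : is_derive (fun u => 1 / (1 + u)) 1 (- (1 / 4))) by (auto_derive; [lra|field]).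
    assert (E1 : 1 / (1 + 1) = 1 / 2) by field.
    assert (DF := HF (1 / (1 + 1)) ltac:(lra)).
    assert (D := is_deriveC_minus _ _ _ _ _ (is_deriveC_comp F (fun u => u / (u + 1)) 1 _ _ DF D1)
                   (is_deriveC_comp F (fun u => 1 / (1 + u)) 1 _ _ DF D2)).
    apply is_deriveC_continuous in D. rewrite <- E1.
    exact (filterlim_at_left (U := C_R_NormedModule) _ _ D).
Qed.

Lemma filterlim_Rpower_at_right_0 (k : R) :
  0 < k -> filterlim (fun t => Rpower t k) (at_right 0) (at_right 0).
Proof.
  intros Hk P [eps HP]. generalize (Rpower_lt_at_right_0 k eps Hk (cond_pos eps)). unfold filtermap.
  apply filter_imp. intros t [_ Ht].
  assert (H : 0 < Rpower t k) by apply exp_pos.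
  apply HP; [|exact H].
  change (Rabs (Rpower t k - 0) < eps). rewrite Rminus_0_r, Rabs_pos_eq; lra.
Qed.

Lemma filterlim_Rpower_ratio_p_infty (k : R) :
  0 < k -> filterlim (fun t => Rpower t k / (Rpower t k + 1)) (Rbar_locally p_infty) (at_left 1).
Proof.
  intros Hk P [eps HP]. assert (He := cond_pos eps).
  (* This threshold solves t^k = 1/eps; beyond it the distance 1/(t^k + 1) to 1 is less than
     [eps]. *)
  exists (Rpower (/ eps) (/ k)). intros t Ht.
  assert (H : / eps < Rpower t k).
  { replace (/ eps) with (Rpower (Rpower (/ eps) (/ k)) k).
    - apply Rlt_Rpower_l; [exact Hk|]. split; [apply exp_pos|exact Ht].
    - rewrite Rpower_mult, Rinv_l, Rpower_1 by (try apply Rinv_0_lt_compat; lra). reflexivity. }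
  assert (H0 : 0 < / eps) by (apply Rinv_0_lt_compat; lra).
  set (T := Rpower t k) in *.
  assert (HT : 0 < / (T + 1)) by (apply Rinv_0_lt_compat; lra).
  assert (E : T / (T + 1) = 1 - / (T + 1)) by (field; lra).
  rewrite E. apply HP; [|lra].
  change (Rabs (1 - / (T + 1) - 1) < eps). rewrite Rabs_left by lra.
  rewrite <- (Rinv_inv eps).
  replace (- (1 - / (T + 1) - 1)) with (/ (T + 1)) by ring.
  apply Rinv_lt_contravar; [apply Rmult_lt_0_compat|]; lra.
Qed.

(* Substitute [u = t^k / (t^k + 1)]. *)
Lemma beta_half_line (k : R) (x y : C) (F : R -> C) (l0 l1 : C) :
  0 < k ->
  (forall t, 0 < t < 1 -> is_deriveC F t (beta_integrand (x / k) (y / k) t)) ->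
  filterlim F (at_right 0) (locally l0) -> filterlim F (at_left 1) (locally l1) ->
  is_RInt_gen (V := C_R_NormedModule)
    (fun t => (Rcpow t (x - 1) * Rcpow (1 + Rpower t k) (- ((x + y) / k)))%C)
    (at_right 0) (Rbar_locally p_infty) (1 / k * (l1 - l0))%C.
Proof.
  intros Hk HF H0 H1.
  assert (Hk0 : RtoC k <> RtoC 0) by (apply RtoC_nonzero; lra).
  set (f := fun t => (Rcpow t (x - 1) * Rcpow (1 + Rpower t k) (- ((x + y) / k)))%C).
  replace (1 / k * (l1 - l0))%C with (1 / k * l1 - 1 / k * l0)%C by ring.
  refine (is_RInt_gen_primitive (V := C_R_CompleteNormedModule) (at_right 0) (Rbar_locally p_infty)
    (fun t => 0 < t) (fun t => 1 / k * F (Rpower t k / (Rpower t k + 1))%R)%C f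
    (1 / k * l0)%C (1 / k * l1)%C _ _ _ _ _ _ _).
  - intros; lra.
  - generalize (at_right_0_lt 1 Rlt_0_1). apply filter_imp. intros; lra.
  - now exists 0.
  - intros t Ht. set (T := Rpower t k).
    assert (HT : 0 < T) by apply exp_pos.
    assert (R1 : 0 < T / (T + 1) < 1).
    { split; [apply Rdiv_lt_0_compat; lra|]. apply Rlt_div_l; lra. }
    assert (D1 : is_derive (fun t => Rpower t k / (Rpower t k + 1)) t
                   (k * Rpower t (k - 1) * / (T + 1) ^ 2)).
    { apply (is_derive_comp (V := R_NormedModule) (fun s => s / (s + 1)) (fun t => Rpower t k)).
      - fold T. auto_derive; [lra|field; lra].
      - now apply is_derive_Rpower. }
    assert (D := is_deriveC_mult _ _ _ _ _ (is_deriveC_const (1 / k)%C t)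
                   (is_deriveC_comp F (fun t => Rpower t k / (Rpower t k + 1)) t _ _ (HF _ R1) D1)).
    match type of D with is_derive _ _ ?l => replace (f t) with l; [exact D|] end.
    rewrite beta_integrand_ratio, Rcpow_one_base by lra.
    unfold f. fold T. rewrite (Rplus_comm 1 T), Rcpow_opp.
    rewrite (Rcpow_Rpower t k (x / k - 1) : Rcpow T _ = _).
    replace (x / k + y / k)%C with ((x + y) / k)%C by (field; exact Hk0).
    (* The first summand of the exponent comes from the Beta integrand at t^k, the second from the
       derivative of t^k; the factor [k] of that derivative cancels the 1/k of the primitive. *)
    replace (x - 1)%C with (RtoC k * (x / k - 1) + (RtoC k - 1))%C by (field; exact Hk0).
    rewrite (Rcpow_plus t (k * (x / k - 1))%C), <- RtoC_minus, Rcpow_RtoC, !RtoC_mult.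
    assert (N1 := Rcpow_nonzero (T + 1) ((x + y) / k)).
    assert (N2 : (RtoC (/ (T + 1) ^ 2) * RtoC ((T + 1) ^ 2))%C = RtoC 1).
    { rewrite <- RtoC_mult. f_equal. field; lra. }
    set (A1 := RtoC (/ (T + 1) ^ 2)) in *. set (A2 := RtoC ((T + 1) ^ 2)) in *.
    set (A3 := Rcpow (T + 1) ((x + y) / k)) in *.
    set (A4 := Rcpow t (k * (x / k - 1))). set (A5 := RtoC (Rpower t (k - 1))).
    transitivity ((A1 * A2) * A4 * A5 / A3)%C.
    + field. split; assumption.
    + rewrite N2. field. exact N1.
  - intros t Ht. eapply is_deriveC_continuous. apply is_deriveC_mult.
    + now apply is_deriveC_Rcpow.
    + apply (is_deriveC_comp (fun s => Rcpow (1 + s) (- ((x + y) / k))) (fun t => Rpower t k)).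
      * apply (is_deriveC_comp (fun s => Rcpow s (- ((x + y) / k))) (fun s => 1 + s)).
        -- apply is_deriveC_Rcpow. assert (0 < Rpower t k) by apply exp_pos. lra.
        -- auto_derive; [trivial|reflexivity].
      * now apply is_derive_Rpower.
  - apply (filterlim_C_mult (at_right 0)); [apply filterlim_const|].
    apply (filterlim_comp _ _ _ (fun t => Rpower t k / (Rpower t k + 1)) F _ (at_right 0)); [|exact H0].
    exact (filterlim_comp _ _ _ _ _ _ _ _ (filterlim_Rpower_at_right_0 k Hk) filterlim_ratio_at_right_0).
  - apply (filterlim_C_mult (Rbar_locally p_infty)); [apply filterlim_const|].
    exact (filterlim_comp _ _ _ _ F _ _ _ (filterlim_Rpower_ratio_p_infty k Hk) H1).
Qed.

Theorem theorem3p1 (k p : R) (x y : C)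
  (hk : 0 < k) (hp : 0 < p) (hx : 0 < Re x) (hy : 0 < Re y) :
  (exists I : C,
     is_RInt_gen (V := C_R_NormedModule)
       (fun t : R => (Rcpow t (x / k - 1) * Rcpow (1 - t) (y / k - 1))%C)
       (at_right 0) (at_left 1) I /\
     pk_beta p k x y = (1 / k * I)%C) /\
  (exists I : C,
     is_RInt_gen (V := C_R_NormedModule)
       (fun t : R => ((Rcpow t (x / k - 1) + Rcpow t (y / k - 1))
                        / Rcpow (t + 1) ((x + y) / k))%C)
       (at_right 0) (at_left 1) I /\
     pk_beta p k x y = (1 / k * I)%C) /\
  (exists I : C,
     is_RInt_gen (V := C_R_NormedModule)
       (fun t : R => (Rcpow t (x - 1)
                        * Rcpow (1 + Rpower t k) (- ((x + y) / k)))%C)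
       (at_right 0) (Rbar_locally p_infty) I /\
     pk_beta p k x y = I) /\
  pk_beta p k x y = (1 / k * Beta (x / k) (y / k))%C.
Proof.
  assert (Hk0 : RtoC k <> RtoC 0) by (apply RtoC_nonzero; lra).
  destruct (beta_primitive (x / k) (y / k)) as (F & l0 & l1 & HF & H0 & H1);
    try (rewrite Re_div_RtoC by exact hk; now apply Rdiv_lt_0_compat).
  assert (HB := is_beta_of_primitive _ _ F l0 l1 HF H0 H1).
  rewrite (pk_beta_eq p k x y _ hp hk hx hy HB).
  split; [|split; [|split]].
  - exists (l1 - l0)%C. split; [exact HB|reflexivity].
  - exists (l1 - l0)%C. split; [|reflexivity].
    replace ((x + y) / k)%C with (x / k + y / k)%C by (field; exact Hk0).
    exact (beta_unit_interval _ _ F l0 l1 HF H0 H1).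
  - exists (1 / k * (l1 - l0))%C. split; [|reflexivity].
    exact (beta_half_line k x y F l0 l1 hk HF H0 H1).
  - f_equal. symmetry. unfold Beta.
    exact (is_RInt_gen_unique (V := C_R_CompleteNormedModule) _ _ HB).
Qed.
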